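(* There is an absolute constant $c_0>0$ such that for every $N\ge1$, every primitive Dirichlet character $\chi$ modulo $N$ and every $f\in S_2^*(N,\chi)$, $$\|f\|_\infty\ \ge\ c_0\prod_{p^c\| N}p^{\frac12\lfloor \frac c2\rfloor},$$ where the product is over primes $p$ and $p^c\|N$ means that $p^c\mid N$ and $p^{c+1}\nmid N$.
   Context: Let $\mathfrak H=\{z=x+iy: y>0\}$. For $N\ge 1$ and a Dirichlet character $\chi$ modulo $N$, consider holomorphic cusp forms $F$ of weight $2$, level $N$ (for the Hecke congruence subgroup $\Gamma_0(N)\subset SL_2(\mathbb Z)$) and nebentypus $\chi$. Such a form is represented by the function $f(z)=yF(z)$, with Fourier expansion $f(z)=y\sum_{n\ge1}a_n n^{1/2}e^{2\pi i nz}$; thus $|f|$ is $\Gamma_0(N)$-invariant and bounded on $\mathfrak H$. $S_2^*(N,\chi)$ denotes the set of primitive forms of this type: newforms of exact level $N$ that are eigenvectors of all Hecke operators $T_n$, $n\ge1$, normalized by $a_1=1$. $\|f\|_\infty=\sup_{z\in\mathfrak H}|f(z)|$. *)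

(* Defs.v *)
From HB Require Import structures.
From mathcomp Require Import all_boot all_order all_algebra.
From mathcomp Require Import all_classical all_reals all_analysis.
From mathcomp Require Import complex.

Set Implicit Arguments.
Unset Strict Implicit.
Unset Printing Implicit Defensive.

Import Order.TTheory GRing.Theory Num.Theory.
Import numFieldNormedType.Exports.

Local Open Scope classical_set_scope.
Local Open Scope ring_scope.
Local Open Scope complex_scope.

(* Dirichlet characters are extended by zero to all integers. *)

Definition dirichlet_character (R : realType) (N : nat) (chi : int -> R[i]) :=
  [/\ forall m n : int, (m = n %[mod N%:Z])%Z -> chi m = chi n,
      forall m n : int, chi (m * n) = chi m * chi n
    & forall m : int, (chi m != 0) = coprimez m N%:Z].

Definition induced_from (R : realType) (N : nat) (chi : int -> R[i])
    (M : nat) (psi : int -> R[i]) :=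
  [/\ (M %| N)%N, dirichlet_character M psi
    & forall m : int, coprimez m N%:Z -> chi m = psi m].

Definition primitive_character (R : realType) (N : nat) (chi : int -> R[i]) :=
  dirichlet_character N chi /\
  ~ exists (M : nat) (psi : int -> R[i]),
      (M < N)%N /\ induced_from N chi M psi.

Definition upper_half (R : realType) : set R[i] :=
  [set z | 0 < complex.Im z].

Definition SL2Z : set 'M[int]_2 := [set g | \det g = 1].

Definition Gamma0 (N : nat) : set 'M[int]_2 :=
  [set g | \det g = 1 /\ (N%:Z %| (g 1 0)%R)%Z].

Definition automorphy (R : realType) (g : 'M[int]_2) (z : R[i]) : R[i] :=
  (g 1 0)%:~R * z + (g 1 1)%:~R.

Definition moebius (R : realType) (g : 'M[int]_2) (z : R[i]) : R[i] :=
  ((g 0 0)%:~R * z + (g 0 1)%:~R) / automorphy g z.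

(* Modular forms are total functions on [R[i]] of
    which only the values on the upper half-plane matter. *)

(* Through the regular module [R[i]^o], [derivable] is complex
   differentiability. *)
Definition holomorphic_on_upper_half (R : realType) (F : R[i] -> R[i]) :=
  forall z, upper_half z -> derivable (F : R[i]^o -> R[i]^o) z 1.

(* [F|g] runs over the expansions of [F] at all the cusps when [g] runs over
   SL_2(Z). *)
Definition vanishes_at_cusps (R : realType) (F : R[i] -> R[i]) :=
  forall g, SL2Z g -> forall e : R, 0 < e ->
  exists Y : R, 0 < Y /\ forall z : R[i], Y < complex.Im z ->
    Normc.normc (automorphy g z ^- 2 * F (moebius g z)) < e.

Definition cusp_form2 (R : realType) (N : nat) (chi : int -> R[i])
    (F : R[i] -> R[i]) :=
  [/\ holomorphic_on_upper_half F,
      forall g z, Gamma0 N g -> upper_half z ->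
        F (moebius g z) = chi (g 1 1) * automorphy g z ^+ 2 * F z
    & vanishes_at_cusps F].

(* Standard fundamental domain of SL_2(Z), in the coordinates (x, y). *)
Definition modular_domain (R : realType) : set (R * R) :=
  [set p | [/\ 0 < p.2, `|p.1| <= 2^-1 & 1 <= p.1 ^+ 2 + p.2 ^+ 2]].

Definition coset_transversal (N : nat) : set (seq 'M[int]_2) :=
  [set s | [/\ uniq s, forall h, h \in s -> SL2Z h
    & forall g, SL2Z g -> exists! h,
        h \in s /\ exists2 k, Gamma0 N k & g = k *m h]].

Definition coset_reps (N : nat) : seq 'M[int]_2 :=
  xget [::] (coset_transversal N).

Definition complex_integral (R : realType) (D : set (R * R))
    (h : R * R -> R[i]) : R[i] :=
  let mu := ((@lebesgue_measure R) \x (@lebesgue_measure R))%E in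
  (\int[mu]_(p in D) complex.Re (h p)) +i* (\int[mu]_(p in D) complex.Im (h p)).

(* The translates of [modular_domain] by [coset_reps N] form a fundamental
   domain of Gamma_0(N); [h] is the Gamma_0(N)-invariant function
   F(w) conj(G(w)) Im(w)^2 and dx dy / y^2 the invariant measure. *)
Definition petersson2 (R : realType) (N : nat) (F G : R[i] -> R[i]) : R[i] :=
  let h (w : R[i]) := F w * conjc (G w) * ((complex.Im w) ^+ 2)%:C in
  \sum_(g <- coset_reps N)
    complex_integral (@modular_domain R)
      (fun p => h (moebius g (p.1 +i* p.2)) * (p.2 ^- 2)%:C).

(* The old space is spanned by the z |-> G(d z) with G of level M a proper
   divisor of N, d a divisor of N / M and the character of G inducing chi. *)
Definition newform2 (R : realType) (N : nat) (chi : int -> R[i])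
    (F : R[i] -> R[i]) :=
  cusp_form2 N chi F /\
  forall (M d : nat) (psi : int -> R[i]) (G : R[i] -> R[i]),
    (M < N)%N -> (M * d %| N)%N -> induced_from N chi M psi ->
    cusp_form2 M psi G ->
    petersson2 N F (fun z => G (d%:R * z)) = 0.

Definition hecke2 (R : realType) (chi : int -> R[i]) (n : nat)
    (F : R[i] -> R[i]) (z : R[i]) : R[i] :=
  n%:R * \sum_(a <- divisors n) chi a%:Z * (n %/ a)%:R ^- 2 *
           \sum_(b < n %/ a) F ((a%:R * z + b%:R) / (n %/ a)%:R).

Definition hecke_eigenform2 (R : realType) (chi : int -> R[i])
    (F : R[i] -> R[i]) :=
  forall n : nat, (1 <= n)%N -> exists lambda : R[i],
  forall z, upper_half z -> hecke2 chi n F z = lambda * F z.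

Definition expi2pi (R : realType) (z : R[i]) : R[i] :=
  let t := 2 * pi * complex.Re z in
  (expR (- (2 * pi * complex.Im z)))%:C * (cos t +i* sin t).

Definition fourier_expansion2 (R : realType) (a : nat -> R[i])
    (F : R[i] -> R[i]) :=
  forall z, upper_half z ->
    (fun m => \sum_(1 <= n < m) a n * (Num.sqrt n%:R)%:C * expi2pi (n%:R * z)
       : R[i]^o) @ \oo --> (F z : R[i]^o).

(* S_2^*(N, chi): the forms are represented by f(z) = y F(z). *)
Definition S2star (R : realType) (N : nat) (chi : int -> R[i]) :
    set (R[i] -> R[i]) :=
  [set f | exists F : R[i] -> R[i],
    [/\ forall z, upper_half z -> f z = (complex.Im z)%:C * F z,
        newform2 N chi F,
        hecke_eigenform2 chi F
      & exists2 a : nat -> R[i], fourier_expansion2 a F & a 1%N = 1]].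

(* Taken in the extended reals, so that it is always the true supremum. *)
Definition sup_norm (R : realType) (f : R[i] -> R[i]) : \bar R :=
  ereal_sup [set (Normc.normc (f z))%:E | z in @upper_half R].

(* Main.v *)
Require Import Defs.
From mathcomp Require Import all_boot all_order all_algebra.
From mathcomp Require Import all_classical all_reals all_analysis.
From mathcomp Require Import measurable_realfun complex.
From mathcomp Require Import cyclic.
From mathcomp Require Import ring lra zify.
Import Order.TTheory GRing.Theory Num.Theory.
Import numFieldNormedType.Exports.
Local Open Scope classical_set_scope.
Local Open Scope ring_scope.
Local Open Scope complex_scope.
Set Implicit Arguments.
Unset Strict Implicit.
Unset Printing Implicit Defensive.

(** Let q be the product of the p^floor(c/2), put M = N / q, so that q divides M,
    and let F be the form, f(z) = Im(z) F(z), with K = sup |f| finite.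

    The growth of f comes from the cusps represented by the matrices
    k_j = (1 0; jM 1).  Since chi(d) = 0 for every divisor d > 1 of N, the operator
    T_q is F |-> (1/q) sum_b F((z + b)/q), b running modulo q; let lam be its
    eigenvalue.  Conjugating k_j by the substitution z |-> (z + b)/q gives an element
    of Gamma_0(N) whose lower right entry is 1 - bjM, and b |-> chi(1 - bM) is an
    additive character modulo q because N divides M^2.  As chi is primitive, this
    character has exact order q, that is zeta = chi(1 - M) is a primitive q-th root
    of unity ([primitive_progression]).  Therefore ([eigen_lower])

      q lam F(k_j z) = (jMz + 1)^2 sum_b zeta^(bj) F((z + b)/q).

    For the j with zeta^j = e(-1/q), the sum on the right keeps exactly the Fourier
    coefficients of F of index 1 modulo q, the first of which is a_1 = 1.  Extracting
    that coefficient on a horizontal line ([coefficient_bound]) yields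
    q e^(-2 pi) <= K |lam|, which is the theorem with c0 = e^(-2 pi) as soon as
    |lam|^2 = q.

    To compute |lam|, take absolute values and sum over j.  Parseval for the
    q-th roots of unity gives, for g = |f|^2,

      sum_b g((z + b)/q) = (|lam|^2 / q) sum_j g(k_j z),

    and the two sums have the same mean value over the quotient of the half-plane by
    Gamma_0(M) ([mean_identity]).  Indeed, write g as the Poincare series over
    Gamma_0(N) of an integrable function kappa.  Since the k_j represent
    Gamma_0(N) \ Gamma_0(M), the sum of the g(k_j z) is the Poincare series of kappa
    over Gamma_0(M); likewise the sum of the g((z + b)/q) is the Poincare series of
    kappa(z/q).  By unfolding, functions with proportional Poincare series have
    proportional integrals for the invariant measure ([hintegral_poincare_eq]); as
    kappa and kappa(z/q) have the same integral, neither zero nor infinite, the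
    factor |lam|^2 / q equals 1.

    The invariant measure is handled in the coordinates z = e^eta (t + i), in which
    dx dy / y^2 becomes dt deta: translations, dilations and z |-> -1/z act by shears
    and reflections, so that invariance is an application of Fubini's theorem.
    The function kappa is g times a weight supported on finitely many translates of
    a Siegel set ([weight_exists]), which have finite volume. *)

(** * Invariant integration on the upper half-plane *)

Section HyperbolicIntegral.
Context {R : realType}.
Local Notation C := R[i].
Local Notation leb := (@lebesgue_measure R).
Local Notation mR := (measurableTypeR R).

Lemma ge0_integral_shift (f : mR -> \bar R) (a : R) :
  measurable_fun [set: mR] f -> (forall x, 0 <= f x)%E ->
  (\int[leb]_x f (x + a : R)%R = \int[leb]_x f x)%E.
Proof.
move=> mf f0.
pose phi (x : measurableTypeR R) : measurableTypeR R := x + a.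
have mphi : measurable_fun setT phi by exact: measurable_funD.
transitivity (\int[pushforward leb phi]_x f x)%E; last first.
  apply: eq_measure_integral => //= A mA _; apply/esym.
  apply: lebesgue_measure_unique => //= _ [[u v]] _ <-.
  rewrite /pushforward.
  have -> : phi @^-1` [set` `]u, v]] = [set` `]u - a, v - a]].
    apply/seteqP; split=> x /=; rewrite !in_itv/= /phi ltrBlDr lerBrDr//.
  rewrite !lebesgue_measure_itv/= !lte_fin ltrD2r.
  by case: ifP => // _; rewrite -!EFinB opprB addrA addrNK.
by rewrite ge0_integral_pushforward.
Qed.

Lemma ge0_integral_opp (f : mR -> \bar R) :
  measurable_fun [set: mR] f -> (forall x, 0 <= f x)%E ->
  (\int[leb]_x f (- x : R)%R = \int[leb]_x f x)%E.
Proof.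
move=> mf f0.
transitivity (\int[pushforward leb (-%R : _ -> measurableTypeR R)]_x f x)%E.
  by rewrite ge0_integral_pushforward.
by apply: eq_measure_integral => //= A mA _; exact: lebesgue_measureN.
Qed.

(** The coordinates (t, eta) of z = e^eta (t + i): the invariant measure
    dx dy / y^2 of the half-plane is dt deta. *)
Definition hpoint (p : R * R) : C := (expR p.2 * p.1) +i* expR p.2.

(** Functions are defined on the whole complex line, but only their values on the
    half-plane, parametrized by [hpoint], are integrated. *)
Definition hmeasurable (k : C -> \bar R) :=
  measurable_fun [set: mR * mR] (k \o hpoint).

Definition hintegral (k : C -> \bar R) : \bar R :=
  (\int[leb \x leb]_(p in [set: mR * mR]) k (hpoint p))%E.

Lemma hintegral_iterated1 (k : C -> \bar R) : hmeasurable k -> (forall z, 0 <= k z)%E ->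
  hintegral k = (\int[leb]_(t in [set: mR]) \int[leb]_(e in [set: mR]) k (hpoint (t, e)))%E.
Proof.
move=> mk k0; rewrite /hintegral.
exact: (@fubini_tonelli1 _ _ _ _ R leb leb (k \o hpoint) mk (fun p => k0 _)).
Qed.

Lemma hintegral_iterated2 (k : C -> \bar R) : hmeasurable k -> (forall z, 0 <= k z)%E ->
  hintegral k = (\int[leb]_(e in [set: mR]) \int[leb]_(t in [set: mR]) k (hpoint (t, e)))%E.
Proof.
move=> mk k0; rewrite /hintegral.
exact: (@fubini_tonelli2 _ _ _ _ R leb leb (k \o hpoint) mk (fun p => k0 _)).
Qed.

(** At fixed eta, z |-> z + s shifts t by the constant s e^(-eta). *)
Lemma hintegral_translate (k : C -> \bar R) (s : R) :
  hmeasurable k -> (forall z, 0 <= k z)%E ->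
  hmeasurable (fun z => k (z + s%:C)) /\ hintegral (fun z => k (z + s%:C)) = hintegral k.
Proof.
move=> mk k0.
pose phi (p : mR * mR) : mR * mR := (p.1 + s * expR (- p.2), p.2).
have E p : hpoint p + s%:C = hpoint (phi p).
  case: p => t e; rewrite /hpoint /phi /=; congr (_ +i* _); last by rewrite addr0.
  by rewrite mulrDr mulrCA expRxMexpNx_1 mulr1.
have mphi : measurable_fun setT phi.
  apply/measurable_fun_pairP; split => //=.
    apply: measurable_funD => //; apply: measurable_funM => //.
    apply: measurableT_comp; first exact: measurable_expR.
    by apply: measurableT_comp.
  exact: measurable_snd.
have m1 : hmeasurable (fun z => k (z + s%:C)).
  rewrite /hmeasurable (_ : _ \o _ = (k \o hpoint) \o phi); first exact: measurableT_comp.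
  by apply/funext => p; rewrite /= E.
split=> //; rewrite (hintegral_iterated2 m1 (fun z => k0 _)) (hintegral_iterated2 mk k0).
apply: eq_integral => e _.
rewrite -[RHS](ge0_integral_shift (s * expR (- e)))//.
  by apply: eq_integral => t _; rewrite /= E.
by apply: (measurableT_comp mk); exact: pair2_measurable.
Qed.

(** A dilation by r shifts eta by ln r and fixes t. *)
Lemma hintegral_scale (k : C -> \bar R) (r : R) : 0 < r ->
  hmeasurable k -> (forall z, 0 <= k z)%E ->
  hmeasurable (fun z => k (r%:C * z)) /\ hintegral (fun z => k (r%:C * z)) = hintegral k.
Proof.
move=> r0 mk k0.
pose phi (p : mR * mR) : mR * mR := (p.1, p.2 + ln r).
have E p : r%:C * hpoint p = hpoint (phi p).
  case: p => t e; rewrite /hpoint /phi /= expRD lnK ?posrE//.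
  by apply/eqP; rewrite eq_complex /=; apply/andP; split; apply/eqP; ring.
have mphi : measurable_fun setT phi.
  apply/measurable_fun_pairP; split => //=.
    exact: measurable_fst.
  exact: measurable_funD.
have m1 : hmeasurable (fun z => k (r%:C * z)).
  rewrite /hmeasurable (_ : _ \o _ = (k \o hpoint) \o phi); first exact: measurableT_comp.
  by apply/funext => p; rewrite /= E.
split=> //; rewrite (hintegral_iterated1 m1 (fun z => k0 _)) (hintegral_iterated1 mk k0).
apply: eq_integral => t _.
rewrite -[RHS](ge0_integral_shift (ln r))//.
  by apply: eq_integral => e _; rewrite /= E.
by apply: (measurableT_comp mk); exact: pair1_measurable.
Qed.

(** Since - 1 / (e^eta (t + i)) = e^(- eta) (- t + i) / (1 + t^2), the inversion sends
    (t, eta) to (- t, - eta - ln (1 + t^2)): at fixed t it is a reflection followed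
    by a shift of eta. *)
Lemma hintegral_inversion (k : C -> \bar R) :
  hmeasurable k -> (forall z, 0 <= k z)%E ->
  hmeasurable (fun z => k (- z^-1)) /\ hintegral (fun z => k (- z^-1)) = hintegral k.
Proof.
move=> mk k0.
(* The action of z |-> -1/z in the coordinates (t, eta). *)
pose phi (p : mR * mR) : mR * mR := (- p.1, - p.2 - ln (1 + p.1 ^+ 2)).
have E p : - (hpoint p)^-1 = hpoint (phi p).
  case: p => t e; rewrite /hpoint /phi /=.
  have e0 := expR_gt0 e; have t0 : 0 < 1 + t ^+ 2 by rewrite ltr_pwDl// sqr_ge0.
  rewrite expRD !expRN lnK ?posrE//.
  have n1 : expR e != 0 by rewrite gt_eqF.
  have n2 : 1 + t ^+ 2 != 0 by rewrite gt_eqF.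
  set w := (X in _ = X); set z := (X in - X^-1).
  have zw : z * w = -1.
    by apply/eqP; rewrite eq_complex /=; apply/andP; split; apply/eqP; field;
      rewrite n1 n2.
  have z0 : z != 0.
    by apply: contra_eq_neq zw => ->; rewrite mul0r eq_sym oppr_eq0 oner_eq0.
  by apply: (mulfI z0); rewrite zw mulrN divff.
have mfst : measurable_fun [set: mR * mR] (fst : _ -> mR) by exact: measurable_fst.
have msnd : measurable_fun [set: mR * mR] (snd : _ -> mR) by exact: measurable_snd.
have mphi : measurable_fun [set: mR * mR] phi.
  apply/measurable_fun_pairP; split.
    exact: (measurable_funN mfst).
  apply: (measurable_funB (measurable_funN msnd)).
  apply: (measurableT_comp (@measurable_ln R)).
  by apply: measurable_funD => //; exact: measurable_funX.
have m1 : hmeasurable (fun z => k (- z^-1)).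
  rewrite /hmeasurable (_ : _ \o _ = (k \o hpoint) \o phi); first exact: measurableT_comp.
  by apply/funext => p; rewrite /= E.
split=> //; rewrite (hintegral_iterated1 m1 (fun z => k0 _)) (hintegral_iterated1 mk k0).
have mF := measurable_fun_fubini_tonelli_F (m2 := leb) _ mk (fun p => k0 _).
rewrite -[RHS]ge0_integral_opp; [|exact: mF|by move=> t; exact: integral_ge0].
apply: eq_integral => t _.
rewrite -[RHS]ge0_integral_opp//; last first.
  by apply: (measurableT_comp mk); exact: pair1_measurable.
pose k' e := k (hpoint (- t, - e)).
rewrite -[RHS](@ge0_integral_shift k' (ln (1 + t ^+ 2))).
- by apply: eq_integral => e _; rewrite /= E /phi /k'/= opprD.
- apply: (measurableT_comp mk); apply/measurable_fun_pairP; split.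
    exact: measurable_cst.
  exact: (measurable_funN (@measurable_id _ mR setT)).
- by move=> e; exact: k0.
Qed.

Lemma upper_half_hpoint p : upper_half (hpoint p).
Proof. exact: expR_gt0. Qed.

Lemma eq_hmeasurable (k k' : C -> \bar R) :
  (forall z, upper_half z -> k z = k' z) -> hmeasurable k = hmeasurable k'.
Proof.
move=> kk'; congr (measurable_fun _ _); apply/funext => p /=.
exact/kk'/upper_half_hpoint.
Qed.

Lemma eq_hintegral (k k' : C -> \bar R) :
  (forall z, upper_half z -> k z = k' z) -> hintegral k = hintegral k'.
Proof. by move=> kk'; apply: eq_integral => p _; exact/kk'/upper_half_hpoint. Qed.

Lemma det_mx22 (g : 'M[int]_2) : \det g = g 0 0 * g 1 1 - g 0 1 * g 1 0.
Proof.
rewrite (expand_det_row _ 0) !big_ord_recl big_ord0 addr0.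
rewrite /cofactor !det_mx11 !mxE /= /bump /=.
have -> : lift 0 (0 : 'I_1) = 1 :> 'I_2 by apply/val_inj.
have -> : lift 1 (0 : 'I_1) = 0 :> 'I_2 by apply/val_inj.
ring.
Qed.

Lemma det_SL2 (g : 'M[int]_2) : SL2Z g -> g 0 0 * g 1 1 - g 0 1 * g 1 0 = 1.
Proof. by rewrite /SL2Z /= det_mx22. Qed.

Lemma intr_complex (n : int) : n%:~R = (n%:~R : R)%:C :> C.
Proof. by rewrite rmorph_int. Qed.

Lemma intr_complexE (n : int) : n%:~R = (n%:~R +i* 0) :> C.
Proof. by rewrite intr_complex. Qed.

Lemma automorphy_neq0 (g : 'M[int]_2) (z : C) : SL2Z g -> upper_half z ->
  automorphy g z != 0.
Proof.
move=> /det_SL2 dg; case: z => x y; rewrite /upper_half /= => y0.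
rewrite /automorphy !intr_complexE eq_complex /= !mul0r !subr0 !addr0.
apply/negP => /andP[/eqP e1 /eqP e2].
have c0 : g 1 0 = 0.
  by apply/eqP; move/eqP: e2; rewrite mulf_eq0 (gt_eqF y0) orbF intr_eq0.
have d0 : g 1 1 = 0.
  by apply/eqP; move/eqP: e1; rewrite c0 mul0r add0r intr_eq0.
by move: dg; rewrite c0 d0 !mulr0 subr0.
Qed.

(** When c is nonzero, (a z + b) / (c z + d) = a / c - 1 / (c^2 z + c d) is a composite
    of dilations, translations and the inversion; when c = 0 it is a translation. *)
Lemma hintegral_moebius (g : 'M[int]_2) (k : C -> \bar R) : SL2Z g ->
  hmeasurable k -> (forall z, 0 <= k z)%E ->
  hmeasurable (fun z => k (moebius g z)) /\ hintegral (fun z => k (moebius g z)) = hintegral k.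
Proof.
move=> Sg mk k0; have dg := det_SL2 Sg.
have [c0|c0] := eqVneq (g 1 0) 0.
  have ad : g 0 0 * g 1 1 = 1 by move: dg; rewrite c0 mulr0 subr0.
  have E z : upper_half z -> k (moebius g z) = k (z + ((g 0 0 * g 0 1)%:~R : R)%:C).
    move=> _; congr (k _); rewrite /moebius /automorphy c0 mulr0z mul0r add0r.
    rewrite -intr_complex intrM.
    have [[-> ->]|[-> ->]] : (g 0 0 = 1 /\ g 1 1 = 1) \/ (g 0 0 = -1 /\ g 1 1 = -1).
      move: ad; move: (g 0 0) (g 1 1) => a d ad.
      have /eqP := congr1 absz ad; rewrite abszM muln_eq1 => /andP[/eqP a1 /eqP d1].
      have [e|e] : a = 1 \/ a = -1 by lia.
        by left; move: ad; rewrite e mul1r.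
      by right; split=> //; move: ad; rewrite e mulN1r => <-; rewrite opprK.
    - by rewrite !mul1r divr1.
    - by rewrite !mulrN1z invrN1 mulrN1 opprD !mulN1r opprK.
  rewrite (eq_hmeasurable E) (eq_hintegral E).
  exact: hintegral_translate.
pose a : R := (g 0 0)%:~R; pose c : R := (g 1 0)%:~R; pose d : R := (g 1 1)%:~R.
have cR0 : c != 0 by rewrite intr_eq0.
(* Reads a / c - 1 / (c^2 z + c d) from the outside inwards. *)
pose k1 (w : C) := k (w + (a / c)%:C).
pose k2 (w : C) := k1 (- w^-1).
pose k3 (w : C) := k2 (w + (c * d)%:C).
have E z : upper_half z -> k (moebius g z) = k3 ((c ^+ 2)%:C * z).
  move=> Hz; congr (k _); rewrite /moebius.
  have A0 := automorphy_neq0 Sg Hz.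
  have -> : (c ^+ 2)%:C * z + (c * d)%:C = c%:C * automorphy g z.
    by rewrite /automorphy !intr_complex -/c -/d !rmorphM /=; ring.
  apply: (mulIf A0); rewrite divfK// invfM mulrDl mulNr mulfVK//.
  have c1 : c%:C != 0 by rewrite fmorph_eq0.
  apply: (mulIf c1); rewrite mulrDl mulNr mulVf//.
  have bE : (g 0 1)%:~R * c%:C = (g 0 0)%:~R * (g 1 1)%:~R - 1 :> C.
    have := congr1 (fun n : int => n%:~R : C) dg.
    by rewrite intrB !intrM mulr1z -intr_complex => /eqP; rewrite subr_eq => /eqP ->; rewrite [1 + _]addrC addrK.
  rewrite mulrDl bE /automorphy rmorphM fmorphV /= !intr_complex -/a -/c -/d.
  by move: a%:C c%:C d%:C c1 => a' c' d' c1; field.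
have k10 z : (0 <= k1 z)%E by exact: k0.
have k20 z : (0 <= k2 z)%E by exact: k0.
have k30 z : (0 <= k3 z)%E by exact: k0.
have [m1 h1] := hintegral_translate (a / c) mk k0.
have [m2 h2] := hintegral_inversion m1 k10.
have [m3 h3] := hintegral_translate (c * d) m2 k20.
have c20 : 0 < c ^+ 2 by rewrite lt_neqAle eq_sym sqrf_eq0 cR0 sqr_ge0.
have [m4 h4] := hintegral_scale c20 m3 k30.
by rewrite (eq_hmeasurable E) (eq_hintegral E) h4 h3 h2 h1.
Qed.

End HyperbolicIntegral.

(** * The action of SL_2(Z) and Poincare series *)

Section ModularGroup.
Context {R : realType}.
Local Notation C := R[i].
Local Notation mR := (measurableTypeR R).

Definition mx2 (a b c d : int) : 'M[int]_2 :=
  \matrix_(i, j) (if i == 0 then if j == 0 then a else b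
                  else if j == 0 then c else d).

Lemma mx2E a b c d :
  (mx2 a b c d 0 0 = a) * (mx2 a b c d 0 1 = b) *
  (mx2 a b c d 1 0 = c) * (mx2 a b c d 1 1 = d).
Proof. by rewrite !mxE. Qed.

Lemma mx2P (A B : 'M[int]_2) :
  [/\ A 0 0 = B 0 0, A 0 1 = B 0 1, A 1 0 = B 1 0 & A 1 1 = B 1 1] -> A = B.
Proof.
move=> [e00 e01 e10 e11]; apply/matrixP => i j.
have cs (k : 'I_2) : k = 0 \/ k = 1.
  by case: k => -[|[|//]] ?; [left|right]; exact/val_inj.
by case: (cs i) => ->; case: (cs j) => ->.
Qed.

Lemma mul_mx2 (A B : 'M[int]_2) i j :
  (A *m B) i j = A i 0 * B 0 j + A i 1 * B 1 j.
Proof.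
rewrite mxE !big_ord_recl big_ord0 addr0.
by have -> : lift ord0 ord0 = 1 :> 'I_2 by apply/val_inj.
Qed.

Lemma automorphyM (g h : 'M[int]_2) (z : C) : automorphy h z != 0 ->
  automorphy (g *m h) z = automorphy g (moebius h z) * automorphy h z.
Proof.
move=> h0; rewrite {1 2}/automorphy mulrDl /moebius -mulrA divfK//.
rewrite !mul_mx2 /automorphy !intrD !intrM; ring.
Qed.

Lemma moebiusM (g h : 'M[int]_2) (z : C) : automorphy h z != 0 ->
  moebius (g *m h) z = moebius g (moebius h z).
Proof.
move=> h0; rewrite [LHS]/moebius automorphyM// [RHS]/moebius.
have -> : ((g *m h) 0 0)%:~R * z + ((g *m h) 0 1)%:~R =
  ((g 0 0)%:~R * moebius h z + (g 0 1)%:~R) * automorphy h z.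
  rewrite mulrDl /moebius -mulrA divfK// !mul_mx2 /automorphy !intrD !intrM; ring.
by rewrite -mulf_div divff// mulr1.
Qed.

Lemma automorphy1 (z : C) : automorphy 1%:M z = 1.
Proof. by rewrite /automorphy !mxE /= mul0r add0r. Qed.

Lemma moebius1 (z : C) : moebius 1%:M z = z.
Proof. by rewrite /moebius automorphy1 !mxE /= mul1r addr0 divr1. Qed.

Lemma Im_moebius (g : 'M[int]_2) (z : C) : SL2Z g -> upper_half z ->
  complex.Im (moebius g z) = complex.Im z / Normc.normc (automorphy g z) ^+ 2.
Proof.
move=> Sg Hz; have := automorphy_neq0 Sg Hz; have := det_SL2 Sg.
have {Hz} : 0 < complex.Im z by [].
case: z => x y /= y0 dg.
rewrite /moebius /automorphy !intr_complexE /=.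
have {dg} : (g 0 0)%:~R * (g 1 1)%:~R - (g 0 1)%:~R * (g 1 0)%:~R = 1 :> R.
  by rewrite -!intrM -intrB dg.
move: (g 0 0)%:~R (g 0 1)%:~R (g 1 0)%:~R (g 1 1)%:~R => a b c d dg.
rewrite !(mul0r, subr0, addr0) sqr_sqrtr ?addr_ge0 ?sqr_ge0// => A0.
have D0 : (c * x + d) ^+ 2 + (c * y) ^+ 2 != 0.
  apply: contraNneq A0 => /eqP.
  rewrite paddr_eq0 ?sqr_ge0// !sqrf_eq0 => /andP[/eqP e1 /eqP e2].
  by rewrite eq_complex /= !(mul0r, subr0, addr0) e1 e2 !eqxx.
rewrite -[RHS]mul1r -[in RHS]dg; field.
exact: D0.
Qed.

Lemma Normc_ge0 (z : C) : 0 <= Normc.normc z.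
Proof. by case: z => x y; exact: sqrtr_ge0. Qed.

Lemma upper_half_moebius (g : 'M[int]_2) (z : C) : SL2Z g -> upper_half z ->
  upper_half (moebius g z).
Proof.
move=> Sg Hz; rewrite /upper_half /= Im_moebius// divr_gt0// exprn_gt0//.
rewrite lt_neqAle Normc_ge0 andbT eq_sym.
by apply/eqP => /Normc.eq0_normc; apply/eqP/automorphy_neq0.
Qed.

Lemma Gamma0_SL2 N g : Gamma0 N g -> SL2Z g. Proof. by case. Qed.

Lemma SL2M g h : SL2Z g -> SL2Z h -> SL2Z (g *m h).
Proof. by rewrite /SL2Z /= det_mulmx => -> ->; rewrite mulr1. Qed.

Lemma Gamma0M N g h : Gamma0 N g -> Gamma0 N h -> Gamma0 N (g *m h).
Proof.
move=> [g1 gN] [h1 hN]; split; first exact: SL2M.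
by rewrite mul_mx2; apply: rpredD; [exact: dvdz_mulr | exact: dvdz_mull].
Qed.

Definition sl2inv (g : 'M[int]_2) := mx2 (g 1 1) (- g 0 1) (- g 1 0) (g 0 0).

Lemma sl2invK g : sl2inv (sl2inv g) = g.
Proof. by apply: mx2P; rewrite /sl2inv !mx2E !opprK. Qed.

Lemma SL2V g : SL2Z g -> SL2Z (sl2inv g).
Proof.
move=> /det_SL2 dg; rewrite /SL2Z /= det_mx22 /sl2inv !mx2E -dg; ring.
Qed.

Lemma Gamma0V N g : Gamma0 N g -> Gamma0 N (sl2inv g).
Proof.
by move=> [g1 gN]; split; [exact: SL2V | rewrite /sl2inv !mx2E rpredN].
Qed.

Lemma mul_sl2V g : SL2Z g -> g *m sl2inv g = 1%:M.
Proof.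
move=> /det_SL2 dg; apply: mx2P; rewrite !mul_mx2 /sl2inv !mx2E !mxE /=.
by split; rewrite -?[1%:R]dg; ring.
Qed.

Lemma mul_Vsl2 g : SL2Z g -> sl2inv g *m g = 1%:M.
Proof. by move=> /SL2V /mul_sl2V; rewrite sl2invK. Qed.

Lemma Vmoebius g (z : C) : SL2Z g -> upper_half z -> moebius (sl2inv g) (moebius g z) = z.
Proof.
by move=> Sg Hz; rewrite -moebiusM ?mul_Vsl2 ?moebius1//; exact: automorphy_neq0.
Qed.

(** Reduces unordered sums over a countable set to series indexed by the natural
    numbers, for which monotone convergence is available; one enumeration serves all
    summands, so that the reduction can be made under an integral sign. *)
Lemma esum_countable (T : countType) (x0 : T) (A : set T) :
  exists e : nat -> T, exists P : pred nat, forall a : T -> \bar R,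
    (forall x, 0 <= a x)%E ->
  (\esum_(x in A) a x = \sum_(n <oo) (if P n then a (e n) else 0))%E.
Proof.
pose P n := if @pickle_inv T n is Some x then `[< A x >] else false.
pose e n := odflt x0 (@pickle_inv T n).
exists e, P => a a0.
rewrite -eseries_mkcond -(esum_pred_image a e P)//.
  congr (esum _ _); apply/seteqP; split=> [x Ax|_ [n Pn <-]] /=.
    by exists (pickle x); rewrite /P /e /= pickleK_inv//; exact/asboolP.
  by move: Pn; rewrite /P /e; case: pickle_inv => //= x /asboolP.
move=> m n; rewrite !inE /P /e.
have /= := @pickle_invK T m; have /= := @pickle_invK T n.
by case: (@pickle_inv T m) => //= x; case: (@pickle_inv T n) => //= y <- <- _ _ ->.
Qed.

Lemma hintegral_esum (A : set 'M[int]_2) (K : 'M[int]_2 -> C -> \bar R) :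
  (forall g z, 0 <= K g z)%E -> (forall g, A g -> hmeasurable (K g)) ->
  hmeasurable (fun z => \esum_(g in A) K g z)%E /\
  hintegral (fun z => \esum_(g in A) K g z)%E = (\esum_(g in A) hintegral (K g))%E.
Proof.
move=> K0 mK.
pose K' g z : \bar R := if `[< A g >] then K g z else 0%E.
have K'0 g z : (0 <= K' g z)%E by rewrite /K'; case: ifP.
have mK' g : hmeasurable (K' g).
  rewrite /K'; case: asboolP => [/mK//|_]; exact: measurable_cst.
have EK z : (\esum_(g in A) K g z = \esum_(g in A) K' g z)%E.
  by apply: eq_esum => g Ag; rewrite /K' asboolT.
have [e [P eP]] := esum_countable (0 : 'M[int]_2) A.
pose f n (p : mR * mR) := (if P n then K' (e n) (hpoint p) else 0)%E.
have mf n : measurable_fun setT (f n).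
  rewrite /f; case: (P n); [exact: mK' | exact: measurable_cst].
have Ef : (fun z => \esum_(g in A) K g z)%E \o hpoint = (fun p => \sum_(n <oo) f n p)%E.
  by apply/funext => p /=; rewrite EK eP.
split.
  rewrite /hmeasurable Ef; apply: ge0_emeasurable_sum => // n p _ _.
  by rewrite /f; case: ifP.
rewrite /hintegral; under eq_integral do rewrite EK eP//.
rewrite integral_nneseries//; last by move=> n p _; rewrite /f; case: ifP.
transitivity (\esum_(g in A) hintegral (K' g))%E.
  rewrite eP; last by move=> g; exact: integral_ge0.
  apply: eq_eseriesr => n _; rewrite /f; case: ifP => // _.
  exact: integral0.
by apply: eq_esum => g Ag; apply: eq_hintegral => z _; rewrite /K' asboolT.
Qed.

Lemma esumZl (T : countType) (x0 : T) (A : set T) (a : T -> \bar R) (r : R) :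
  (forall x, 0 <= a x)%E -> 0 <= r ->
  (\esum_(x in A) (r%:E * a x) = r%:E * \esum_(x in A) a x)%E.
Proof.
move=> a0 r0; have [e [P eP]] := esum_countable x0 A.
rewrite !eP//; last by move=> x; rewrite mule_ge0.
rewrite -nneseriesZl; last by move=> n _; case: ifP.
by apply: eq_eseriesr => n _; case: ifP => //; rewrite mule0.
Qed.

Definition poincare (M : nat) (k : C -> \bar R) (z : C) : \bar R :=
  (\esum_(g in Gamma0 M) k (moebius g z))%E.

(** Right multiplication by an element of the group permutes the terms. *)
Lemma poincare_inv M k g z : (forall z, 0 <= k z)%E -> Gamma0 M g -> upper_half z ->
  poincare M k (moebius g z) = poincare M k z.
Proof.
move=> k0 Gg Hz; rewrite /poincare.
have bij : set_bij (Gamma0 M) (Gamma0 M) (fun h => h *m g).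
  split.
  - by move=> h Gh; exact: Gamma0M.
  - move=> h h' _ _ /(congr1 (mulmx^~ (sl2inv g))).
    by rewrite -!mulmxA mul_sl2V ?mulmx1//; exact: Gamma0_SL2 Gg.
  - move=> h Gh; exists (h *m sl2inv g); first exact/Gamma0M/Gamma0V.
    by rewrite -mulmxA mul_Vsl2 ?mulmx1//; exact: Gamma0_SL2 Gg.
rewrite [RHS](@reindex_esum _ _ _ _ _ _ _ bij); apply: eq_esum => h Gh.
by rewrite moebiusM//; apply: automorphy_neq0 => //; exact: Gamma0_SL2 Gg.
Qed.

Lemma set_bij_sl2inv M : set_bij (Gamma0 M) (Gamma0 M) sl2inv.
Proof.
split.
- by move=> g; exact: Gamma0V.
- by move=> g h _ _; apply: (can_inj sl2invK).
- by move=> g Gg; exists (sl2inv g); [exact: Gamma0V | exact: sl2invK].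
Qed.

Lemma hmeasurableM (k v : C -> \bar R) :
  hmeasurable k -> hmeasurable v -> hmeasurable (fun z => k z * v z)%E.
Proof. exact: emeasurable_funM. Qed.

Lemma hintegral_poincareM M (k v : C -> R) :
  hmeasurable (EFin \o k) -> hmeasurable (EFin \o v) ->
  (forall z, 0 <= k z) -> (forall z, 0 <= v z) ->
  hintegral (fun z => (k z)%:E * poincare M (EFin \o v) z)%E =
  (\esum_(g in Gamma0 M) hintegral (fun z => (k z * v (moebius g z))%:E))%E.
Proof.
move=> mk mv k0 v0.
have E z : upper_half z -> ((k z)%:E * poincare M (EFin \o v) z)%E =
    (\esum_(g in Gamma0 M) (k z * v (moebius g z))%:E)%E.
  by move=> _; rewrite /poincare -(esumZl 0)// => g; rewrite lee_fin.
rewrite (eq_hintegral E).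
apply: (hintegral_esum _ _).2.
  by move=> g z; rewrite lee_fin mulr_ge0.
move=> g /Gamma0_SL2 Sg; apply: (hmeasurableM (v := fun z => (v (moebius g z))%:E) mk).
by apply: (hintegral_moebius Sg mv _).1 => z; rewrite lee_fin.
Qed.

(** Unfolding: the integral of k(z) v(g z) equals that of k(g^-1 z) v(z), and g |-> g^-1
    permutes the group. *)
Lemma hintegral_poincare_duality M (k v : C -> R) :
  hmeasurable (EFin \o k) -> hmeasurable (EFin \o v) ->
  (forall z, 0 <= k z) -> (forall z, 0 <= v z) ->
  hintegral (fun z => (k z)%:E * poincare M (EFin \o v) z)%E =
  hintegral (fun z => (v z)%:E * poincare M (EFin \o k) z)%E.
Proof.
move=> mk mv k0 v0; rewrite !hintegral_poincareM//.
rewrite [RHS](@reindex_esum _ _ _ _ _ _ _ (set_bij_sl2inv M)).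
apply: eq_esum => g /Gamma0_SL2 Sg.
have SVg := SL2V Sg.
pose phi z : \bar R := (v z * k (moebius (sl2inv g) z))%:E.
have phi0 z : (0 <= phi z)%E by rewrite lee_fin mulr_ge0.
have mphi : hmeasurable phi.
  apply: (hmeasurableM (v := fun z => (k (moebius (sl2inv g) z))%:E) mv).
  by apply: (hintegral_moebius SVg mk _).1 => z; rewrite lee_fin.
have /esym E := (hintegral_moebius Sg mphi phi0).2.
apply: (etrans _ (esym E)).
by apply: eq_hintegral => z Hz; rewrite /phi Vmoebius// mulrC.
Qed.

(** A function v whose Poincare series is 1 plays the part of a fundamental domain:
    by duality the integral of k is that of v times the Poincare series of k. *)
Lemma hintegral_poincare_eq M (k k' v : C -> R) (r : R) : 0 <= r ->
  hmeasurable (EFin \o k) -> hmeasurable (EFin \o k') -> hmeasurable (EFin \o v) ->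
  (forall z, 0 <= k z) -> (forall z, 0 <= k' z) -> (forall z, 0 <= v z) ->
  (forall z, upper_half z -> poincare M (EFin \o v) z = 1%E) ->
  (forall z, upper_half z -> poincare M (EFin \o k') z =
     r%:E * poincare M (EFin \o k) z)%E ->
  hintegral (EFin \o k') = (r%:E * hintegral (EFin \o k))%E.
Proof.
move=> r0 mk mk' mv k0 k'0 v0 v1 kk'.
have J (u : C -> R) : hmeasurable (EFin \o u) -> (forall z, 0 <= u z) ->
    hintegral (EFin \o u) = hintegral (fun z => (v z)%:E * poincare M (EFin \o u) z)%E.
  move=> mu u0; rewrite -hintegral_poincare_duality//.
  by apply: eq_hintegral => z Hz; rewrite v1// mule1.
rewrite J// (J k)// -ge0_integralZl//.
- rewrite /hintegral.
  apply: eq_integral => p _.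
  rewrite (kk' _ (upper_half_hpoint p)).
  exact: muleCA.
- apply: (hmeasurableM mv).
  apply: (hintegral_esum _ _).1 => [g z|g /Gamma0_SL2 Sg]; first by rewrite lee_fin.
  by apply: (hintegral_moebius Sg mk _).1 => z; rewrite lee_fin.
- move=> p _; apply: mule_ge0; first by rewrite lee_fin.
  by apply: esum_ge0 => g _; rewrite lee_fin.
Qed.

End ModularGroup.

(** * Siegel sets *)

Section Siegel.
Context {R : realType}.
Local Notation C := R[i].
Local Notation mR := (measurableTypeR R).

(** Larger than the standard fundamental domain: the condition y >= 1/2 is reached by
    an elementary reduction, and the volume is still finite. *)
Definition siegel (z : C) : bool :=
  (`|complex.Re z| <= 2^-1) && (2^-1 <= complex.Im z).

Definition shift_mx (m : int) := mx2 1 m 0 1.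
Definition inv_mx := mx2 0 (-1) 1 0.

Lemma SL2_shift m : SL2Z (shift_mx m).
Proof. by rewrite /SL2Z /= det_mx22 !mx2E; ring. Qed.

Lemma SL2_inv : SL2Z inv_mx.
Proof. by rewrite /SL2Z /= det_mx22 !mx2E; ring. Qed.

Lemma moebius_shift m (z : C) : moebius (shift_mx m) z = z + (m%:~R : R)%:C.
Proof.
by rewrite /moebius /automorphy !mx2E mul0r add0r divr1 mul1r -intr_complex.
Qed.

(** If |x| <= 1/2 and y < 1/2 then |z|^2 <= 1/2, hence z |-> -1/z at least doubles the
    imaginary part.  Alternating with translations reaches the Siegel set after
    finitely many steps. *)
Lemma siegel_cover (z : C) : upper_half z ->
  exists2 g, SL2Z g & siegel (moebius g z).
Proof.
(* n bounds the number of doublings of the imaginary part that are still needed. *)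
suff H n : forall z : C, upper_half z -> 2^-1 <= complex.Im z * 2 ^+ n ->
    exists2 g, SL2Z g & siegel (moebius g z).
  move=> Hz; have y0 : 0 < complex.Im z by [].
  have [n hn] : exists n : nat, (complex.Im z)^-1 < n%:R.
    by exists (Num.bound (complex.Im z)^-1); rewrite archi_boundP// invr_ge0 ltW.
  apply: (H n) => //.
  have : n%:R <= 2 ^+ n :> R by rewrite -natrX ler_nat ltnW// ltn_expl.
  move=> /(lt_le_trans hn); rewrite -(ltr_pM2l y0) divff ?gt_eqF//.
  by move: (_ * _) => u; lra.
elim: n => [|n IH] {}z Hz hz.
- pose m : int := - Num.floor (complex.Re z + 2^-1).
  exists (shift_mx m); first exact: SL2_shift.
  rewrite moebius_shift /siegel /m {m}; case: z Hz hz => x y /= Hz hz.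
  have /andP[] := floor_itv (x + 2^-1).
  rewrite intrD mulr1z addr0 mulrNz ler_norml => h1 h2.
  move: hz; rewrite expr0 mulr1 => ->; rewrite andbT.
  by apply/andP; split; lra.
pose m : int := - Num.floor (complex.Re z + 2^-1).
pose z1 := moebius (shift_mx m) z.
have Hz1 : upper_half z1 by exact/upper_half_moebius/Hz/SL2_shift.
have E1 : complex.Im z1 = complex.Im z.
  by rewrite /z1 moebius_shift; case: (z) => x y /=; rewrite addr0.
have X1 : `|complex.Re z1| <= 2^-1.
  rewrite /z1 moebius_shift /m; case: (z) => x y /=.
  have /andP[] := floor_itv (x + 2^-1).
  rewrite intrD mulr1z mulrNz ler_norml => h1 h2.
  by apply/andP; split; lra.
have [y1|y1] := leP 2^-1 (complex.Im z1).
  by exists (shift_mx m); [exact: SL2_shift | rewrite /siegel X1].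
have [|//|g Sg hg] := IH (moebius inv_mx z1).
- exact/upper_half_moebius/Hz1/SL2_inv.
- rewrite Im_moebius//; last exact: SL2_inv.
  have y0 : 0 < complex.Im z1 by [].
  have -> : Normc.normc (automorphy inv_mx z1) ^+ 2 =
      complex.Re z1 ^+ 2 + complex.Im z1 ^+ 2.
    rewrite /automorphy !mx2E mul1r addr0; case: (z1) => x y /=.
    by rewrite sqr_sqrtr// addr_ge0 ?sqr_ge0.
  have D1 : complex.Re z1 ^+ 2 + complex.Im z1 ^+ 2 <= 2^-1.
    move: X1 y1 y0; rewrite ler_norml => /andP[]; move: (complex.Re _) (complex.Im _) => x y.
    by move=> *; nra.
  have D0 : 0 < complex.Re z1 ^+ 2 + complex.Im z1 ^+ 2.
    by rewrite ltr_wpDl ?sqr_ge0 ?exprn_gt0.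
  apply: (le_trans hz); rewrite -E1 exprS mulrA ler_wpM2r ?exprn_ge0//.
  rewrite ler_pM2l// -[X in X <= _]invrK lef_pV2 ?posrE ?invr_gt0//.
exists (g *m (inv_mx *m shift_mx m)).
  by apply: SL2M => //; apply: SL2M; [exact: SL2_inv | exact: SL2_shift].
have A1 := automorphy_neq0 (SL2_shift m) Hz.
have A2 := automorphy_neq0 SL2_inv Hz1.
rewrite moebiusM ?moebiusM// automorphyM// mulf_neq0//.
Qed.

End Siegel.

Section SiegelFinite.
Context {R : realType}.
Local Notation C := R[i].
Local Notation mR := (measurableTypeR R).

Lemma finite_bounded_mx (B : R) (A : set 'M[int]_2) :
  (forall g i j, A g -> `|(g i j)%:~R| <= B) -> finite_set A.
Proof.
move=> gB; pose n := Num.bound B.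
pose f (u : 'M['I_n.*2.+1]_2) : 'M[int]_2 := map_mx (fun i => (nat_of_ord i)%:Z - n%:Z) u.
apply: (@sub_finite_set _ _ (f @` setT)); last exact/finite_image/finite_finset.
move=> g Ag /=.
have b i j : (absz (g i j) <= n)%N.
  have := gB g i j Ag; rewrite -intr_norm -natr_absz => h.
  have B0 : 0 <= B by apply: le_trans h; exact: ler0n.
  by have := le_lt_trans h (archi_boundP B0); rewrite ltr_nat => /ltnW.
exists (\matrix_(i, j) inord (absz (g i j + n%:Z))) => //.
apply/matrixP => i j; rewrite !mxE inordK.
  by have := b i j; move: (g i j) => k; lia.
by have := b i j; move: (g i j) => k; lia.
Qed.

(** The numbers p and q are the coordinates of the image (a z + b) / (c z + d) of
    z = x + i y.  From q |c z + d|^2 = y and q >= 1/2 the bottom row is bounded;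
    then q is bounded, because |c z + d| cannot be small, and a z + b is the product
    of the image by c z + d. *)
Lemma siegel_entry_bounds (x y p q a b c d : R) :
  let U := 1 + 2 * y in let V := U / 2 + (y + y^-1) * U in
  let B := V + U + U / y * (1 + `|x|) + V / y * (1 + `|x|) in
  0 < y -> `|p| <= 2^-1 -> 2^-1 <= q ->
  q * ((c * x + d) ^+ 2 + (c * y) ^+ 2) = y ->
  p * (c * x + d) - q * (c * y) = a * x + b ->
  p * (c * y) + q * (c * x + d) = a * y ->
  1 <= c ^+ 2 \/ c = 0 /\ 1 <= d ^+ 2 ->
  [/\ `|a| <= B, `|b| <= B, `|c| <= B & `|d| <= B].
Proof.
move=> U V B y0 hp hq hD hb ha hcd.
have yV0 : 0 < y^-1 by rewrite invr_gt0.
have U0 : 0 < U by rewrite /U; lra.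
have V0 : 0 < V.
  have : 0 < (y + y^-1) * U by apply: mulr_gt0 => //; exact: addr_gt0.
  by rewrite /V; move: (_ * U) => w; lra.
have x0 : 0 <= `|x| by [].
have Uy0 : 0 < U / y by rewrite divr_gt0.
have Vy0 : 0 < V / y by rewrite divr_gt0.
set u := c * x + d in hD hb ha; set v := c * y in hD hb ha.
have D2 : u ^+ 2 + v ^+ 2 <= 2 * y.
  have : 0 <= u ^+ 2 + v ^+ 2 by rewrite addr_ge0 ?sqr_ge0.
  by move: (u ^+ 2 + v ^+ 2) hD => D; nra.
have hU : u ^+ 2 <= U ^+ 2 /\ v ^+ 2 <= U ^+ 2.
  have := sqr_ge0 u; have := sqr_ge0 v; have := sqr_ge0 y.
  have -> : U ^+ 2 = 1 + 4 * y + 4 * y ^+ 2 by rewrite /U; ring.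
  by move=> *; split; lra.
have hu : `|u| <= U.
  have : `|u| ^+ 2 <= U ^+ 2 by rewrite real_normK ?num_real//; case: hU.
  by rewrite ler_sqr ?nnegrE ?(ltW U0).
have hv : `|v| <= U.
  have : `|v| ^+ 2 <= U ^+ 2 by rewrite real_normK ?num_real//; case: hU.
  by rewrite ler_sqr ?nnegrE ?(ltW U0).
have hQ : q <= y + y^-1.
  case: hcd => [c1|[c0 d1]].
    apply: (@le_trans _ _ y^-1); last by lra.
    have v2 : y ^+ 2 <= v ^+ 2 by rewrite /v exprMn ler_peMl ?sqr_ge0.
    rewrite -[leRHS]mul1r ler_pdivlMr// -(ler_pM2r y0) mul1r -[leRHS]hD -mulrA -expr2.
    rewrite ler_pM2l; last by lra.
    by have := sqr_ge0 u; lra.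
  apply: (@le_trans _ _ y); last by lra.
  rewrite -[leRHS]hD /u /v c0 !mul0r add0r expr0n /= addr0.
  by rewrite ler_peMr//; lra.
have hV (r s : R) : `|r| <= U -> `|s| <= U -> `|p * r + q * s| <= V.
  move=> hr hs; apply: (le_trans (ler_normD _ _)); rewrite !normrM /V.
  apply: lerD; first by rewrite [leRHS]mulrC ler_pM.
  by rewrite ler_pM// ger0_norm//; lra.
have aB : `|a| <= V / y.
  rewrite ler_pdivlMr// -[X in _ * X <= _](gtr0_norm y0) -normrM -ha.
  exact: hV.
have cB : `|c| <= U / y.
  by rewrite ler_pdivlMr// -[X in _ * X <= _](gtr0_norm y0) -normrM.
have bB : `|b| <= V + V / y * `|x|.
  have -> : b = (p * u + q * - v) - a * x by rewrite mulrN hb addrC addKr.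
  apply: (le_trans (ler_normB _ _)); apply: lerD; first by apply: hV; rewrite ?normrN.
  by rewrite normrM ler_wpM2r.
have dB : `|d| <= U + U / y * `|x|.
  have -> : d = u - c * x by rewrite /u addrC addKr.
  apply: (le_trans (ler_normB _ _)); apply: lerD => //.
  by rewrite normrM ler_wpM2r.
have m1 : 0 <= U / y * `|x| by apply: mulr_ge0 => //; exact: ltW.
have m2 : 0 <= V / y * `|x| by apply: mulr_ge0 => //; exact: ltW.
rewrite /B; split; rewrite ?mulrDr ?mulr1; lra.
Qed.

(** Local finiteness: an orbit meets the Siegel set finitely often, counted with
    stabilizers. *)
Lemma siegel_finite (z : C) : upper_half z ->
  finite_set [set g | SL2Z g /\ siegel (moebius g z)].
Proof.
case: z => x y; rewrite /upper_half /= => y0.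
pose U := 1 + 2 * y; pose V := U / 2 + (y + y^-1) * U.
pose B := V + U + U / y * (1 + `|x|) + V / y * (1 + `|x|).
apply: (@finite_bounded_mx B) => g i j [Sg].
have Hz : upper_half (x +i* y) by [].
have A0 := automorphy_neq0 Sg Hz; have /= Im0 := Im_moebius Sg Hz.
pose w := moebius g (x +i* y).
have wE : w * automorphy g (x +i* y) = (g 0 0)%:~R * (x +i* y) + (g 0 1)%:~R.
  by rewrite /w /moebius divfK.
have D0 : 0 < Normc.normc (automorphy g (x +i* y)) ^+ 2.
  rewrite exprn_gt0// lt_neqAle Normc_ge0 andbT eq_sym.
  by apply/eqP => /Normc.eq0_normc; apply/eqP.
move: Im0 => /(congr1 ( *%R^~ (Normc.normc (automorphy g (x +i* y)) ^+ 2))).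
rewrite divfK ?gt_eqF//.
rewrite /siegel -/w; case: w wE => p q /=.
rewrite /automorphy !intr_complexE /=.
rewrite !(mul0r, subr0, addr0, oppr0, add0r) sqr_sqrtr ?addr_ge0 ?sqr_ge0//.
move=> [h1 h2] h3 /andP[h4 h5]; rewrite !(mul0r, subr0, addr0) in h1 h2.
have hcd : 1 <= (g 1 0)%:~R ^+ 2 :> R \/ (g 1 0)%:~R = 0 :> R /\ 1 <= (g 1 1)%:~R ^+ 2 :> R.
  have dg := det_SL2 Sg; rewrite -!rmorphXn /= !ler1z.
  have [c0|c0] := eqVneq (g 1 0) 0; [right|left].
    by rewrite c0; split=> //; move: dg; rewrite c0; move: (g 0 0) (g 1 1) => a d; nia.
  by move: c0; move: (g 1 0) => c; nia.
have [] := siegel_entry_bounds y0 h4 h5 h3 h1 _ hcd.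
  exact: h2.
rewrite -/U -/V -/B => ba bb bc bd.
have cs (k : 'I_2) : k = 0 \/ k = 1.
  by case: k => -[|[|//]] ?; [left|right]; exact/val_inj.
by case: (cs i) => ->; case: (cs j) => ->.
Qed.

End SiegelFinite.

(** * Weights with Poincare series one *)

Section Weights.
Context {R : realType}.
Local Notation C := R[i].
Local Notation mR := (measurableTypeR R).
Local Notation leb := (@lebesgue_measure R).

Definition siegel_ind (z : C) : R := (siegel z)%:R.

Lemma siegel_ind_ge0 z : 0 <= siegel_ind z. Proof. exact: ler0n. Qed.

Lemma hmeasurable_siegel : hmeasurable (EFin \o siegel_ind).
Proof.
rewrite /hmeasurable; apply/measurable_EFinP; rewrite /comp.
have m1 : measurable_fun [set: mR * mR] (fun p : mR * mR => expR p.2).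
  by apply: measurableT_comp; [exact: measurable_expR | exact: measurable_snd].
have m2 : measurable_fun [set: mR * mR] (fun p : mR * mR => `|expR p.2 * p.1| <= 2^-1).
  apply: measurable_fun_ler => //.
  apply: measurableT_comp; first exact: normr_measurable.
  by apply: measurable_funM => //; exact: measurable_fst.
have m3 : measurable_fun [set: mR * mR] (fun p : mR * mR => 2^-1 <= expR p.2).
  exact: measurable_fun_ler.
suff -> : (fun p : mR * mR => siegel_ind (hpoint p)) = fun p : mR * mR =>
    if (`|expR p.2 * p.1| <= 2^-1) && (2^-1 <= expR p.2) then 1 else 0.
  by apply: measurable_fun_ifT => //; exact: measurable_and.
by apply/funext => p /=; rewrite /siegel_ind /siegel /=; case: ifP.
Qed.

(** At height e^eta the set has t-length e^(- eta), so its volume is the integral of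
    e^(- eta) over e^eta >= 1/2; this is recognized as twice a shifted exponential
    density. *)
Lemma hintegral_siegel : (hintegral (EFin \o siegel_ind) < +oo)%E.
Proof.
rewrite /hintegral (fubini_tonelli2 (fun p : mR * mR => (siegel_ind (hpoint p))%:E))//; last 2 first.
- exact: hmeasurable_siegel.
- by move=> p; rewrite lee_fin siegel_ind_ge0.
have E (e : mR) : fubini_G leb (fun p : mR * mR => (siegel_ind (hpoint p))%:E) e =
    (2%:E * (exponential_pdf 1 (e + ln 2))%:E)%E.
  rewrite /fubini_G /exponential_pdf patchE mem_setE in_itv /= andbT.
  have e2 : (0 <= e + ln 2) = (2^-1 <= expR e) :> bool.
    rewrite -ler_expR expRD expR0 lnK ?posrE//.
    by rewrite -ler_pdivrMr// div1r.
  rewrite e2.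
  have [he|he] := boolP (2^-1 <= expR e); last first.
    rewrite mule0 integral0_eq// => t _.
    by rewrite /siegel_ind /siegel /= (negbTE he) andbF.
  pose r := expR (- e) / 2.
  have e0 := expR_gt0 e.
  (* The condition |x| <= 1/2 reads |t| <= e^(- eta) / 2. *)
  transitivity (\int[leb]_(t in [set: mR]) (\1_`[- r, r]%classic t)%:E)%E.
    apply: eq_integral => t _; rewrite /siegel_ind /siegel /= he andbT indicE mem_setE in_itv /=.
    congr (_%:R%:E); rewrite normrM (gtr0_norm e0) -ler_norml /r expRN; congr nat_of_bool.
    by rewrite -ler_pdivlMl.
  rewrite integral_indic// setIT /= lebesgue_measure_itv /= lte_fin.
  have r0 : 0 < r by rewrite divr_gt0 ?expR_gt0.
  rewrite ifT; last by lra.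
  rewrite -EFinB -EFinM; congr (_%:E).
  rewrite mul1r mulN1r opprD expRD [expR (- ln 2)]expRN lnK ?posrE// /r; lra.
rewrite (eq_integral _ _ (fun e _ => E e)).
have pm : measurable_fun [set: mR] (fun e : mR => (exponential_pdf 1 (e + ln 2))%:E).
  apply/measurable_EFinP; apply: measurableT_comp; first exact: measurable_exponential_pdf.
  exact: measurable_funD.
rewrite ge0_integralZl//; last by move=> e _; rewrite lee_fin exponential_pdf_ge0.
rewrite (@ge0_integral_shift _ (fun e => (exponential_pdf 1 e)%:E)).
- by rewrite integral_exponential_pdf// mule1 ltry.
- by apply/measurable_EFinP; exact: measurable_exponential_pdf.
- by move=> e; rewrite lee_fin exponential_pdf_ge0.
Qed.

End Weights.

Section CosetWeights.
Context {R : realType}.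
Local Notation C := R[i].
Local Notation mR := (measurableTypeR R).

(** One matrix is chosen in each residue class modulo N that meets SL_2(Z): matrices
    in the same class differ by an element of the principal congruence subgroup. *)
Lemma Gamma0_finite_index (N : nat) : (0 < N)%N ->
  exists2 s : seq 'M[int]_2, {in s, forall h, SL2Z h} &
    forall g, SL2Z g -> exists2 h, h \in s & Gamma0 N (sl2inv h *m g).
Proof.
case: N => // N _.
pose r (g : 'M[int]_2) : 'M['I_N.+1]_2 := map_mx (fun k => inord (absz (k %% N.+1%:Z)%Z)) g.
pose f (u : 'M['I_N.+1]_2) : 'M[int]_2 := xget 1%:M [set g | SL2Z g /\ r g = u].
have SL21 : SL2Z 1%:M by rewrite /SL2Z /= det1.
exists [seq f u | u : 'M['I_N.+1]_2].
  move=> h /codomP[u ->]; rewrite /f.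
  by case: xgetP => [x _ []|_].
move=> g Sg; exists (f (r g)); first exact: codom_f.
have [Sh rE] : SL2Z (f (r g)) /\ r (f (r g)) = r g.
  rewrite /f; case: xgetP => [h _ [] //|/(_ g)].
  by case.
move: (f (r g)) Sh rE => h Sh rE; split; first by apply: SL2M => //; exact: SL2V.
have E i j : ((h i j)%Z = g i j %[mod N.+1%:Z])%Z.
  have b (k : int) : (absz (k %% N.+1%:Z)%Z < N.+1)%N.
    by rewrite -ltz_nat gez0_abs ?modz_ge0// ltz_pmod.
  have := congr1 (fun u : 'M['I_N.+1]_2 => nat_of_ord (u i j)) rE.
  rewrite !mxE !inordK ?b// => /(congr1 Posz).
  by rewrite !gez0_abs ?modz_ge0.
have E' i j : (N.+1%:Z %| (h i j - g i j)%R)%Z.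
  by rewrite -eqz_mod_dvd; apply/eqP.
rewrite mul_mx2 /sl2inv !mx2E.
have -> : - h 1 0 * g 0 0 + h 0 0 * g 1 0 =
  (h 0 0 - g 0 0) * g 1 0 - (h 1 0 - g 1 0) * g 0 0 by ring.
by apply: rpredB; exact: dvdz_mulr.
Qed.

Lemma esum_lt_pinfty (T : choiceType) (A : set T) (a : T -> \bar R) :
  (forall x, 0 <= a x < +oo)%E -> finite_set (A `&` [set x | a x != 0%E]) ->
  (\esum_(x in A) a x < +oo)%E.
Proof.
move=> a0 fA; rewrite (esumID [set x | a x != 0%E])//; last first.
  by move=> x _; case/andP: (a0 x).
rewrite [X in (_ + X)%E]esum1 ?adde0; last first.
  by move=> x [_ /negP]; rewrite negbK => /eqP.
rewrite esum_fset//; last by move=> x _; case/andP: (a0 x).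
rewrite fsbig_finite//=; apply: lte_sum_pinfty => x _.
by case/andP: (a0 x).
Qed.

Lemma esum_ge_term (T : choiceType) (A : set T) (a : T -> \bar R) x :
  (forall x, 0 <= a x)%E -> A x -> (a x <= \esum_(x in A) a x)%E.
Proof.
move=> a0 Ax; apply: esum_ge; exists [set x]; first by split => // y ->.
by rewrite fsbig_set1.
Qed.

(** The weight is the indicator w of finitely many translates of the Siegel set,
    counted with multiplicity, divided by the Poincare series W of w.  The covering
    property gives W >= 1, local finiteness gives W finite, and W is invariant. *)
Lemma weight_exists (N : nat) : (0 < N)%N -> exists v : C -> R,
  [/\ hmeasurable (EFin \o v), forall z, 0 <= v z,
      forall z, upper_half z -> poincare N (EFin \o v) z = 1%E
    & (hintegral (EFin \o v) < +oo)%E].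
Proof.
move=> N0; have [s sS scov] := Gamma0_finite_index N0.
pose w (z : C) : R := \sum_(h <- s) siegel_ind (moebius h z).
have w0 z : 0 <= w z by apply: sumr_ge0 => h _; exact: siegel_ind_ge0.
have wE : EFin \o w = (fun z => \sum_(h <- s) (siegel_ind (moebius h z))%:E)%E.
  by apply/funext => z /=; rewrite /w sumEFin.
have ms h : h \in s -> hmeasurable (fun z : C => (siegel_ind (moebius h z))%:E).
  move=> hs; apply: (hintegral_moebius (sS h hs) hmeasurable_siegel _).1 => z.
  by rewrite lee_fin siegel_ind_ge0.
have mw : hmeasurable (EFin \o w).
  rewrite wE /hmeasurable (_ : _ \o hpoint =
    (fun p => \sum_(h <- s) (if h \in s then (siegel_ind (moebius h (hpoint p)))%:E else 0))%E).
    apply: emeasurable_sum => h.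
    by have [/ms//|_] := boolP (h \in s); exact: measurable_cst.
  by apply/funext => p /=; rewrite big_seq [RHS]big_seq; apply: eq_bigr => h ->.
pose W := poincare N (EFin \o w).
have W1 z : upper_half z -> (1 <= W z)%E.
  move=> Hz; have [g Sg sg] := siegel_cover Hz.
  have [h hs Gh] := scov g Sg.
  have a0 k : (0 <= (w (moebius k z))%:E)%E by rewrite lee_fin.
  apply: le_trans (esum_ge_term a0 Gh).
  have E : siegel_ind (moebius h (moebius (sl2inv h *m g) z)) = 1.
    rewrite -moebiusM; last by apply: automorphy_neq0 => //; exact: Gamma0_SL2 Gh.
    by rewrite mulmxA mul_sl2V ?mul1mx /siegel_ind ?sg//; exact: sS.
  rewrite lee_fin /w (perm_big _ (perm_to_rem hs)) big_cons E lerDl.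
  by apply: sumr_ge0 => k _; exact: siegel_ind_ge0.
have Wy z : upper_half z -> (W z < +oo)%E.
  move=> Hz; apply: esum_lt_pinfty => [g|]; first by rewrite lee_fin w0 ltry.
  apply: (@sub_finite_set _ _ (\bigcup_(h in [set` s])
      (fun g => sl2inv h *m g) @` [set g | SL2Z g /\ siegel (moebius g z)])).
    move=> g [/Gamma0_SL2 Sg /=]; rewrite eqe => wn0.
    have : has (fun h => siegel (moebius h (moebius g z))) s.
      apply: contraNT wn0 => /hasPn hn; apply/eqP; rewrite /w big_seq big1// => h hs.
      by rewrite /siegel_ind (negbTE (hn h hs)).
    move=> /hasP[h hs hg]; exists h => //=; exists (h *m g).
      split; first by apply: SL2M => //; exact: sS.
      by rewrite moebiusM//; exact: automorphy_neq0.
    by rewrite mulmxA mul_Vsl2 ?mul1mx//; exact: sS.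
  apply: bigcup_finite => // h _; exact/finite_image/siegel_finite.
have Wfin z : upper_half z -> W z = (fine (W z))%:E.
  by move=> Hz; rewrite fineK// ge0_fin_numE ?Wy// (le_trans _ (W1 z Hz)).
(* The inverse is written as a real power because powers are measurable functions. *)
pose v (z : C) : R := w z * (fine (W z)) `^ (-1).
have v0 z : 0 <= v z by rewrite mulr_ge0 ?powR_ge0.
have mW : hmeasurable W.
  apply: (hintegral_esum _ _).1 => [g z|g /Gamma0_SL2 Sg]; first by rewrite lee_fin.
  by apply: (hintegral_moebius Sg mw _).1 => z; rewrite lee_fin.
have mv : hmeasurable (EFin \o v).
  rewrite /hmeasurable; apply/measurable_EFinP; apply: measurable_funM.
    exact/measurable_EFinP.
  apply: (measurableT_comp (measurable_powR _)).
  exact: (measurableT_comp (fine_measurable _)).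
exists v; split => //.
- move=> z Hz; rewrite /poincare.
  transitivity (\esum_(g in Gamma0 N) ((fine (W z) `^ (-1))%:E * (w (moebius g z))%:E))%E.
    apply: eq_esum => g Gg; rewrite /= /v.
    have -> : W (moebius g z) = W z by apply: poincare_inv => // u; rewrite lee_fin.
    by rewrite EFinM muleC.
  rewrite (esumZl 0) ?powR_ge0//; last by move=> g; rewrite lee_fin.
  rewrite -/(poincare N (EFin \o w) z) -/(W z) [in X in (_ * X)%E]Wfin// -EFinM.
  have fW : 1 <= fine (W z) by rewrite -lee_fin -Wfin ?W1.
  by rewrite powR_inv1 ?mulVf// ?gt_eqF//; lra.
- apply: (@le_lt_trans _ _ (hintegral (EFin \o w))).
    apply: ge0_le_integral => //.
    + by move=> p _; rewrite lee_fin.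
    + move=> p _; rewrite lee_fin /v ler_piMr//.
      have fW : 1 <= fine (W (hpoint p)) by rewrite -lee_fin -Wfin ?W1//; exact: upper_half_hpoint.
      by rewrite powR_inv1 ?invf_le1//; lra.
  pose K (h : 'M[int]_2) (z : C) : \bar R :=
    if h \in s then (siegel_ind (moebius h z))%:E else 0%E.
  rewrite wE (@eq_hintegral _ _ (fun z => \sum_(h <- s) K h z)%E); last first.
    by move=> z _; rewrite big_seq [RHS]big_seq; apply: eq_bigr => h hs; rewrite /K hs.
  rewrite /hintegral ge0_integral_sum//.
  + rewrite big_seq; apply: lte_sum_pinfty => h hs.
    have si0 (z : C) : (0 <= (EFin \o siegel_ind) z)%E.
      by rewrite lee_fin siegel_ind_ge0.
    have [_ E] := hintegral_moebius (sS h hs) hmeasurable_siegel si0.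
    rewrite [X in (X < _)%E](_ : _ = hintegral (EFin \o siegel_ind)); first exact: hintegral_siegel.
    by rewrite -E; apply: eq_hintegral => z _; rewrite /K hs.
  + by move=> h; rewrite /K; have [/ms//|_] := boolP (h \in s); exact: measurable_cst.
  + by move=> h p _; rewrite /K; case: ifP => // _; rewrite lee_fin siegel_ind_ge0.
Qed.

End CosetWeights.

(** * Comparison of two averages over cosets *)

Section MeanIdentity.
Context {R : realType}.
Local Notation C := R[i].
Local Notation mR := (measurableTypeR R).

Lemma solve_mod (q : nat) (c d : int) : (0 < q)%N -> coprimez d q%:Z ->
  exists j : 'I_q, (q%:Z %| (c - (j : nat)%:Z * d)%R)%Z.
Proof.
move=> q0 /coprimezP[[u v] /= uv].
have m0 : 0 <= ((c * u) %% q%:Z)%Z by rewrite modz_ge0//; lia.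
have mq : ((c * u) %% q%:Z)%Z < q%:Z by rewrite ltz_pmod.
have jq : (absz ((c * u) %% q%:Z)%Z < q)%N by lia.
exists (Ordinal jq) => /=; rewrite gez0_abs//.
have := divz_eq (c * u) q%:Z; move: (_ %/ _)%Z (_ %% _)%Z => s t E.
apply/dvdzP; exists (c * v + s * d).
have -> : t = c * u - s * q by rewrite E addrC addKr.
have -> : c - (c * u - s * q) * d = c - c * (u * d) + s * q * d by ring.
have -> : u * d = 1 - v * q%:Z by rewrite -uv addrK.
ring.
Qed.

Lemma ord_eq_mod (q : nat) (i j : 'I_q) (d : int) : coprimez d q%:Z ->
  (q%:Z %| (d * ((i : nat)%:Z - (j : nat)%:Z))%R)%Z -> i = j.
Proof.
move=> dq; rewrite Gauss_dvdzr 1?coprimez_sym// => /dvdzP[k E].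
apply/val_inj => /=; move: E (ltn_ord i) (ltn_ord j).
move: (nat_of_ord i) (nat_of_ord j) => m n E im jn.
have k0 : k = 0.
  have [k0|k0|//] := ltrgtP k 0.
    have : k * q%:Z <= - q%:Z by nia.
    lia.
  have : q%:Z <= k * q%:Z by nia.
  lia.
by move: E; rewrite k0; lia.
Qed.

Lemma coprime_of_det (a b c d : int) (q : nat) :
  a * d - b * c = 1 -> (q%:Z %| c)%Z -> coprimez a q%:Z /\ coprimez d q%:Z.
Proof.
move=> E /dvdzP[k ck]; split; apply/coprimezP.
  by exists (d, - b * k) => /=; rewrite -E ck; ring.
by exists (a, - b * k) => /=; rewrite -E ck; ring.
Qed.

(** Regroups a double sum: by [e], a representative x j together with an element of
    Gamma_0(N) amounts to an element of the larger group. *)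
Lemma sum_poincare (q M N : nat) (kap kap' : C -> R) (z : C) (x : 'I_q -> C)
    (e : 'I_q * 'M[int]_2 -> 'M[int]_2) :
  (forall z, 0 <= kap z) ->
  set_bij ([set: 'I_q] `*`` (fun=> Gamma0 N)) (Gamma0 M) e ->
  (forall j g, Gamma0 N g -> kap' (moebius (e (j, g)) z) = kap (moebius g (x j))) ->
  (\sum_(j < q) poincare N (EFin \o kap) (x j) = poincare M (EFin \o kap') z)%E.
Proof.
move=> k0 be E; rewrite /poincare (@reindex_esum _ _ _ _ _ _ _ be).
transitivity (\esum_(j in [set: 'I_q]) \esum_(g in Gamma0 N) (kap (moebius g (x j)))%:E)%E.
  rewrite esum_fset; [|exact: finite_finset|by move=> j _; apply: esum_ge0 => g _; rewrite lee_fin].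
  rewrite fsbig_seq ?index_enum_uniq//.
  have -> : [set` index_enum 'I_q] = [set: 'I_q] by
    apply/seteqP; split=> // j _ /=; exact: mem_index_enum.
  by [].
rewrite esum_esum; last by move=> j g _ _; rewrite lee_fin.
by apply: eq_esum => -[j g] [_ Gg] /=; rewrite E.
Qed.

Definition lower_mx (c : int) := mx2 1 0 c 1.

(** The matrices (1 0; jM 1) represent the right cosets of Gamma_0(N) in Gamma_0(M):
    j is found by solving a congruence modulo q, whose coefficient is a unit because
    q divides M. *)
Lemma set_bij_lower_mx (q M N : nat) : (0 < q)%N -> N = (q * M)%N -> (q %| M)%N -> (0 < M)%N ->
  set_bij ([set: 'I_q] `*`` (fun=> Gamma0 N)) (Gamma0 M)
    (fun p => p.2 *m lower_mx ((p.1 : nat)%:Z * M%:Z)).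
Proof.
move=> q0 NE qM M0.
have MN : (M%:Z %| N%:Z)%Z by rewrite NE PoszM dvdz_mull.
have qMz : (q%:Z %| M%:Z)%Z by [].
have Sl c : SL2Z (lower_mx c) by rewrite /SL2Z /= det_mx22 !mx2E; ring.
have cop g : Gamma0 M g -> coprimez (g 1 1) q%:Z.
  move=> [/det_SL2 dg gM]; have := coprime_of_det dg (dvdz_trans qMz gM).
  by case.
have lowK c : lower_mx c *m lower_mx (- c) = 1%:M.
  by apply: mx2P; rewrite !mul_mx2 !mx2E !mxE /=; split; ring.
have lowKV c : lower_mx (- c) *m lower_mx c = 1%:M.
  by rewrite -[X in _ *m lower_mx X]opprK lowK.
split.
- move=> [j g] [_ [Sg gN]] /=; split; first exact: SL2M.
  rewrite mul_mx2 !mx2E mulr1; apply: rpredD; first exact: dvdz_trans gN.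
  by rewrite mulrA dvdz_mull.
- move=> [j g] [j' g'] /set_mem[_ [/= Sg gN]] /set_mem[_ [/= Sg' gN']] E.
  have E11 := congr1 (fun u : 'M[int]_2 => u 1 1) E.
  have E10 := congr1 (fun u : 'M[int]_2 => u 1 0) E.
  rewrite !mul_mx2 !mx2E !(mulr0, add0r, mulr1) in E11 E10.
  have jj : j = j'.
    apply: (@ord_eq_mod _ _ _ (g 1 1)).
      by apply: cop; split => //; exact: dvdz_trans gN.
    have Mn0 : M%:Z != 0 by lia.
    rewrite -(dvdz_mul2r Mn0) -PoszM -NE.
    have -> : g 1 1 * ((j : nat)%:Z - (j' : nat)%:Z) * M%:Z = g' 1 0 - g 1 0.
      by rewrite -E11 in E10; lia.
    exact: rpredB.
  move: E; rewrite jj => /(congr1 (mulmx^~ (lower_mx (- ((j' : nat)%:Z * M%:Z))))).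
  by rewrite -!mulmxA lowK !mulmx1 => ->.
- move=> h [Sh /[dup] hM /dvdzP[c' hc]] /=.
  have [|j jE] := solve_mod c' q0 (cop h _); first by split.
  exists (j, h *m lower_mx (- ((j : nat)%:Z * M%:Z))) => /=.
    split => //=; split; first exact: SL2M.
    rewrite mul_mx2 !mx2E mulr1 hc NE PoszM.
    have -> : c' * M%:Z + h 1 1 * - ((j : nat)%:Z * M%:Z) = (c' - (j : nat)%:Z * h 1 1) * M%:Z.
      by ring.
    exact: dvdz_mul.
  by rewrite -mulmxA lowKV mulmx1.
Qed.

(** The product diag(1, q)^-1 g (1 b; 0 q), which is integral when q divides the lower
    left entry of g. *)
Definition upper_conj (q : nat) (b : int) (g : 'M[int]_2) : 'M[int]_2 :=
  mx2 (g 0 0) (g 0 0 * b + g 0 1 * q%:Z)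
      ((g 1 0)%R %/ q%:Z)%Z (((g 1 0)%R %/ q%:Z)%Z * b + g 1 1).

(** The sets Gamma_0(N) (1 b; 0 q), for b modulo q, are disjoint and have union
    diag(1, q) Gamma_0(M). *)
Lemma set_bij_upper_conj (q M N : nat) : (0 < q)%N -> N = (q * M)%N -> (q %| M)%N -> (0 < M)%N ->
  set_bij ([set: 'I_q] `*`` (fun=> Gamma0 N)) (Gamma0 M)
    (fun p => upper_conj q (p.1 : nat)%:Z p.2).
Proof.
move=> q0 NE qM M0.
have qN : (q%:Z %| N%:Z)%Z by rewrite NE PoszM dvdz_mulr.
have qMz : (q%:Z %| M%:Z)%Z by [].
have qn0 : q%:Z != 0 by lia.
split.
- move=> [j g] [_ [/det_SL2 dg gN]] /=; have := dvdz_trans qN gN.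
  move=> /dvdzP[k gk]; rewrite /upper_conj gk mulzK//; split.
    rewrite /= det_mx22 !mx2E -dg gk; ring.
  rewrite !mx2E -(dvdz_mul2r qn0) -gk; apply: dvdz_trans gN.
  by rewrite NE PoszM mulrC.
- move=> [j g] [j' g'] /set_mem[_ [/= /det_SL2 dg gN]] /set_mem[_ [/= /det_SL2 dg' gN']].
  have /dvdzP[k gk] := dvdz_trans qN gN; have /dvdzP[k' gk'] := dvdz_trans qN gN'.
  have [ca _] := coprime_of_det dg (dvdz_trans qN gN).
  rewrite /upper_conj gk gk' !mulzK// => E.
  have E00 := congr1 (fun u : 'M[int]_2 => u 0 0) E.
  have E01 := congr1 (fun u : 'M[int]_2 => u 0 1) E.
  have E10 := congr1 (fun u : 'M[int]_2 => u 1 0) E.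
  have E11 := congr1 (fun u : 'M[int]_2 => u 1 1) E.
  rewrite !mx2E in E00 E01 E10 E11.
  have jj : j = j'.
    apply: (@ord_eq_mod _ _ _ (g 0 0)) => //.
    apply/dvdzP; exists (g' 0 1 - g 0 1); rewrite -E00 in E01; lia.
  congr (_, _) => //; apply: mx2P; split.
  - exact: E00.
  - by rewrite jj -E00 in E01; apply: (mulIf qn0); exact: addrI E01.
  - by rewrite gk gk' E10.
  - by rewrite jj E10 in E11; exact: addrI E11.
- move=> h [/det_SL2 dh hM] /=.
  have [ca _] := coprime_of_det dh (dvdz_trans qMz hM).
  have [b /dvdzP[r hr]] := solve_mod (h 0 1) q0 ca.
  exists (b, mx2 (h 0 0) r (h 1 0 * q%:Z) (h 1 1 - h 1 0 * (b : nat)%:Z)) => /=.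
    split => //=; split.
      rewrite /= det_mx22 !mx2E.
      have -> : h 0 0 * (h 1 1 - h 1 0 * (b : nat)%:Z) - r * (h 1 0 * q%:Z) =
        h 0 0 * h 1 1 - h 1 0 * ((b : nat)%:Z * h 0 0 + r * q%:Z) by ring.
      by rewrite -hr -dh; ring.
    by rewrite !mx2E NE PoszM [h 1 0 * _]mulrC dvdz_mul.
  apply: mx2P; rewrite /upper_conj !mx2E mulzK//; split => //.
    by rewrite -hr; ring.
  by ring.
Qed.

Lemma upper_half_affine (q b : nat) (z : C) : (0 < q)%N -> upper_half z ->
  upper_half ((z + b%:R) / q%:R).
Proof.
move=> q0; rewrite /upper_half /= => Hz.
have -> : b%:R = (b%:R : R)%:C :> C by rewrite rmorph_nat.
have -> : q%:R^-1 = (q%:R^-1 : R)%:C :> C by rewrite fmorphV rmorph_nat.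
case: z Hz => x y /= y0; rewrite mulr0 add0r addr0 mulr_gt0// invr_gt0 ltr0n//.
Qed.

Lemma moebius_upper_conj (q N b : nat) (h : 'M[int]_2) (z : C) : (0 < q)%N ->
  (q %| N)%N -> Gamma0 N h ->
  (q%:R^-1 : R)%:C * moebius (upper_conj q b%:Z h) z = moebius h ((z + b%:R) / q%:R).
Proof.
move=> q0 qN [_ hN].
have qC : q%:R != 0 :> C by rewrite pnatr_eq0 -lt0n.
have qNz : (q%:Z %| N%:Z)%Z by [].
have /dvdzP[k hk] := dvdz_trans qNz hN.
have -> : (q%:R^-1 : R)%:C = q%:R^-1 :> C by rewrite fmorphV rmorph_nat.
rewrite /moebius /automorphy /upper_conj !mx2E hk mulzK; last by lia.
rewrite !intrD !intrM -!pmulrn mulrA; congr (_ / _); field => //.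
Qed.

(** Both sides are Poincare series over Gamma_0(M), of the functions k(z/q) and k(z)
    where k is g times a weight for Gamma_0(N).  These have the same integral, which
    is finite because g is bounded, and nonzero because otherwise g, a countable sum
    of translates of k, would have integral zero. *)
Lemma mean_identity (q M N : nat) (g : C -> R) (r B : R) :
  (0 < q)%N -> N = (q * M)%N -> (q %| M)%N -> (0 < M)%N ->
  hmeasurable (EFin \o g) -> (forall z, 0 <= g z) -> (forall z, upper_half z -> g z <= B) ->
  (forall h z, Gamma0 N h -> upper_half z -> g (moebius h z) = g z) ->
  (0 < hintegral (EFin \o g))%E -> 0 <= r ->
  (forall z, upper_half z -> \sum_(b < q) g ((z + b%:R) / q%:R) =
     r * \sum_(j < q) g (moebius (lower_mx ((j : nat)%:Z * M%:Z)) z)) ->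
  r = 1.
Proof.
move=> q0 NE qM M0 mg g0 gB gN g1 r0 gr.
have N0 : (0 < N)%N by rewrite NE muln_gt0 q0.
have [v [mv v0 v1 vy]] := @weight_exists R N N0.
have [v' [mv' v'0 v'1 _]] := @weight_exists R M M0.
(* The Poincare series of k over Gamma_0(N) is g, because that of v is 1. *)
pose k (z : C) := g z * v z.
have k0 z : 0 <= k z by rewrite mulr_ge0.
have mk : hmeasurable (EFin \o k) := hmeasurableM mg mv.
have qR : 0 < q%:R^-1 :> R by rewrite invr_gt0 ltr0n.
have qC : q%:R != 0 :> C by rewrite pnatr_eq0 -lt0n.
pose k' (z : C) := k ((q%:R^-1 : R)%:C * z).
have k'0 z : 0 <= k' z by exact: k0.
have [mk' hk'] := hintegral_scale qR mk (fun z => ltac:(by rewrite lee_fin)).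
have B0 : 0 <= B.
  by apply: le_trans (gB (hpoint (0, 0)) _) => //; exact: upper_half_hpoint.
have ky : (hintegral (EFin \o k) < +oo)%E.
  apply: (@le_lt_trans _ _ (B%:E * hintegral (EFin \o v))%E).
    rewrite -ge0_integralZl//; last by move=> p _; rewrite lee_fin.
    apply: ge0_le_integral => //.
    - by move=> p _; rewrite lee_fin.
    - exact: (measurable_funeM B%:E mv).
    move=> p _; rewrite /= -EFinM lee_fin ler_wpM2r// gB//.
    exact: upper_half_hpoint.
  by rewrite lte_mul_pinfty.
have kP z : upper_half z -> poincare N (EFin \o k) z = (g z)%:E.
  move=> Hz; transitivity (\esum_(h in Gamma0 N) ((g z)%:E * (v (moebius h z))%:E))%E.
    by apply: eq_esum => h Gh; rewrite /= /k gN// EFinM.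
  rewrite (esumZl 0)//; last by move=> h; rewrite lee_fin.
  by rewrite -[X in (_ * X)%E]/(poincare N (EFin \o v) z) v1// mule1.
have kpos : (0 < hintegral (EFin \o k))%E.
  rewrite lt_neqAle integral_ge0 ?andbT; last by move=> p _; rewrite lee_fin.
  apply/negP => /eqP h0; move: g1.
  rewrite (@eq_hintegral _ _ (poincare N (EFin \o k))); last by move=> z Hz; rewrite kP.
  have -> : hintegral (poincare N (EFin \o k)) =
      (\esum_(h in Gamma0 N) hintegral (fun z => (k (moebius h z))%:E))%E.
    apply: (hintegral_esum _ _).2 => [h z|h /Gamma0_SL2 Sh]; first by rewrite lee_fin.
    by apply: (hintegral_moebius Sh mk _).1 => z; rewrite lee_fin.
  rewrite esum1 ?ltxx// => h /Gamma0_SL2 Sh.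
  by rewrite (hintegral_moebius Sh mk (fun z => ltac:(by rewrite lee_fin))).2.
have E : hintegral (EFin \o k') = (r%:E * hintegral (EFin \o k))%E.
  apply: (@hintegral_poincare_eq _ M k k' v') => // z Hz.
  have A (j : 'I_q) : Gamma0 M (lower_mx ((j : nat)%:Z * M%:Z)).
    split; first by rewrite /= det_mx22 !mx2E; ring.
    by rewrite !mx2E dvdz_mull.
  rewrite -(@sum_poincare q M N k k' z (fun b => (z + b%:R) / q%:R) _ k0 (set_bij_upper_conj q0 NE qM M0)); last first.
    move=> b h Gh; rewrite /k' (@moebius_upper_conj _ N)//.
    by rewrite NE dvdn_mulr.
  rewrite -(@sum_poincare q M N k k z (fun j => moebius (lower_mx ((j : nat)%:Z * M%:Z)) z) _ k0 (set_bij_lower_mx q0 NE qM M0)); last first.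
    move=> j h Gh; rewrite /= moebiusM//; apply: automorphy_neq0 => //; exact: Gamma0_SL2 (A j).
  under eq_bigr => b _.
    rewrite kP; last exact: upper_half_affine.
    over.
  under [in RHS]eq_bigr => j _.
    rewrite kP; last by apply: upper_half_moebius => //; exact: Gamma0_SL2 (A j).
    over.
  by rewrite !sumEFin gr.
move: E; rewrite [hintegral (EFin \o k')]hk'.
move: kpos ky; case: (hintegral (EFin \o k)) => [s| |] //.
rewrite lte_fin => s0 _; rewrite -EFinM => -[] /esym /eqP.
by rewrite -subr_eq0 -{2}[s]mul1r -mulrBl mulf_eq0 (gt_eqF s0) orbF subr_eq0 => /eqP.
Qed.

End MeanIdentity.

(** * The root of unity attached to a primitive character *)

Section Character.
Context {R : realType}.
Local Notation C := R[i].

Lemma dirichlet1 (N : nat) (chi : int -> C) : dirichlet_character N chi -> chi 1 = 1.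
Proof.
move=> [_ cM c0]; have n0 : chi 1 != 0 by rewrite c0 /coprimez gcd1z.
by apply: (mulfI n0); rewrite -cM !mulr1.
Qed.

(** Modulo N, the numbers 1 - bM multiply by adding the b, because q divides M and so
    N = qM divides M^2. *)
Lemma character_progression (q M N : nat) (chi : int -> C) (b : nat) :
  N = (q * M)%N -> (q %| M)%N -> dirichlet_character N chi ->
  chi (1 - b%:Z * M%:Z) = chi (1 - M%:Z) ^+ b.
Proof.
move=> NE /dvdnP[k kM] cchi; have [cP cM _] := cchi.
elim: b => [|b IH]; first by rewrite mul0r subr0 (dirichlet1 cchi).
rewrite exprS -IH -cM; apply: cP; apply/eqP; rewrite eqz_mod_dvd.
apply/dvdzP; exists (- b%:Z * k%:Z); rewrite NE PoszM kM PoszM -addn1 PoszD; ring.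
Qed.

(** N divides (mM)^2, so N and its divisor mM have the same prime factors. *)
Lemma coprimez_level (q M N m : nat) (a : int) : N = (q * M)%N -> (q %| M)%N ->
  (m %| q)%N -> coprimez a (m * M)%N%:Z = coprimez a N%:Z.
Proof.
move=> NE /dvdnP[k kM] mq; rewrite !coprimezE !absz_nat; apply/idP/idP => h.
  have : coprime (absz a) ((m * M) ^ 2)%N by rewrite coprimeXr.
  apply: coprime_dvdr; apply/dvdnP; exists (m * m * k)%N.
  by rewrite NE expnS expn1 {2}kM; lia.
by apply: coprime_dvdr h; rewrite NE; exact: dvdn_mul.
Qed.

(** If zeta had order m < q, then chi would be trivial on the residues congruent to 1
    modulo mM, hence would be periodic modulo mM; as mM has the same prime factors as
    N, chi itself would be a character modulo mM, a proper divisor of N. *)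
Lemma primitive_progression (q M N : nat) (chi : int -> C) : (0 < q)%N -> (0 < M)%N ->
  N = (q * M)%N -> (q %| M)%N -> primitive_character N chi ->
  q.-primitive_root (chi (1 - M%:Z)).
Proof.
move=> q0 M0 NE qM [cchi prim]; have [cP cM c0] := cchi.
have pr := character_progression _ NE qM cchi.
set zeta := chi _; have zq : zeta ^+ q = 1.
  rewrite /zeta -pr -(dirichlet1 cchi); apply: cP; apply/eqP; rewrite eqz_mod_dvd.
  by apply/dvdzP; exists (-1); rewrite NE PoszM; ring.
have [m mz mq] := prim_order_exists q0 zq.
have [<-//|mq'] := eqVneq m q.
have m0 : (0 < m)%N by rewrite (prim_order_gt0 mz).
have mlt : (m < q)%N by rewrite ltn_neqAle mq' dvdn_leq.
exfalso; apply: prim; exists (m * M)%N, chi; split.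
  by rewrite NE ltn_pmul2r.
have cop a := @coprimez_level q M N m a NE qM mq.
split; [by rewrite NE dvdn_mul | | by []].
split => //; last by move=> a; rewrite cop.
move=> a b ab.
have [bN|bN] := boolP (coprimez b N%:Z); last first.
  have aN : ~~ coprimez a N%:Z.
    by rewrite -cop /coprimez -gcdz_modl ab gcdz_modl -/(coprimez _ _) cop.
  by move: aN bN; rewrite -!c0 !negbK => /eqP -> /eqP ->.
have /coprimezP[[u v] /= uv] := bN.
have un0 : chi u != 0.
  by rewrite c0; apply/coprimezP; exists (b, v) => /=; rewrite mulrC.
apply: (mulfI un0); rewrite -!cM.
have -> : chi (u * b) = 1.
  rewrite -(dirichlet1 cchi); apply: cP; apply/eqP; rewrite eqz_mod_dvd -uv.
  by apply/dvdzP; exists (- v); ring.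
move/eqP: ab; rewrite eqz_mod_dvd => /dvdzP[k kE].
(* u a is congruent to 1 + u k m M modulo N, and m divides the residue x of - u k m
   modulo q; hence chi (u a) = zeta^x = 1. *)
pose x := ((- (u * k * m%:Z)) %% q%:Z)%Z.
have x0 : 0 <= x by rewrite modz_ge0//; lia.
have mx : (m %| absz x)%N.
  have : (m%:Z %| x)%Z.
    rewrite /x; have := divz_eq (- (u * k * m%:Z)) q%:Z.
    move: (_ %/ _)%Z (_ %% _)%Z => s t E.
    have -> : t = - (u * k * m%:Z) - s * q%:Z by rewrite E addrC addKr.
    apply: rpredB; first by rewrite rpredN dvdz_mull.
    exact: dvdz_mull.
  by rewrite -[X in (_ %| X)%Z](gez0_abs x0).
transitivity (chi (1 - (absz x)%:Z * M%:Z)).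
  apply: cP; apply/eqP; rewrite eqz_mod_dvd gez0_abs//.
  have := divz_eq (- (u * k * m%:Z)) q%:Z; rewrite -/x; move: (_ %/ _)%Z => s sE.
  have xE : x = - (u * k * m%:Z) - s * q%:Z by rewrite sE addrC addKr.
  have aE : a = b + k * (m%:Z * M%:Z) by rewrite -PoszM -kE addrC subrK.
  apply/dvdzP; exists (- v - s); rewrite xE aE -uv NE PoszM; ring.
by rewrite pr; move/dvdnP: mx => [y ->]; rewrite mulnC exprM (prim_expr_order mz) expr1n.
Qed.

End Character.

(** * The Hecke relation at the cusps *)

Section Identities.
Context {R : realType}.
Local Notation C := R[i].
Local Notation normc := (@Normc.normc R).

Lemma sqr_normcE (z : C) : (normc z ^+ 2)%:C = z * conjc z.
Proof.
case: z => x y; rewrite /Normc.normc sqr_sqrtr ?addr_ge0 ?sqr_ge0//.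
by apply/eqP; rewrite eq_complex /=; apply/andP; split; apply/eqP; ring.
Qed.

Lemma normc1 : normc 1 = 1. Proof. exact: Normc.normc1. Qed.

Lemma normcX (z : C) n : normc (z ^+ n) = normc z ^+ n.
Proof.
elim: n => [|n IH]; first by rewrite !expr0 normc1.
by rewrite !exprS Normc.normcM IH.
Qed.

Lemma normc_root (z : C) n : (0 < n)%N -> z ^+ n = 1 -> normc z = 1.
Proof.
move=> n0 zn; have := congr1 normc zn; rewrite normcX normc1 => /eqP.
by rewrite pexpr_eq1 ?Normc_ge0// => /eqP.
Qed.

Lemma sum_root_powers (q : nat) (eta : C) : eta ^+ q = 1 -> eta != 1 ->
  \sum_(j < q) eta ^+ j = 0.
Proof.
move=> eq1 en1; have := subrX1 eta q; rewrite eq1 subrr => /esym/eqP.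
by rewrite mulf_eq0 subr_eq0 (negbTE en1) /= => /eqP.
Qed.

Lemma parseval_roots (q : nat) (zeta : C) (x : 'I_q -> C) : (0 < q)%N ->
  q.-primitive_root zeta ->
  \sum_(j < q) normc (\sum_(b < q) zeta ^+ (b * j) * x b) ^+ 2 =
  q%:R * \sum_(b < q) normc (x b) ^+ 2.
Proof.
move=> q0 pz; have zq := prim_expr_order pz.
have nz : normc zeta = 1 by exact: normc_root zq.
have z0 : zeta != 0 by apply: contra_eq_neq nz => ->; rewrite Normc.normc0 eq_sym oner_eq0.
have zc : conjc zeta = zeta^-1.
  apply: (mulfI z0); rewrite divff// -sqr_normcE nz expr1n//.
apply: (@complexI R); rewrite rmorphM rmorph_nat !rmorph_sum /=.
have E (j : 'I_q) : (normc (\sum_(b < q) zeta ^+ (b * j) * x b) ^+ 2)%:C =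
   \sum_(b < q) \sum_(b' < q) (zeta ^+ b / zeta ^+ b') ^+ j * (x b * conjc (x b')).
  rewrite sqr_normcE rmorph_sum /= mulr_suml; apply: eq_bigr => b _.
  rewrite mulr_sumr; apply: eq_bigr => b' _.
  rewrite rmorphM rmorphXn /= zc !exprM exprMn !exprVn; ring.
rewrite (eq_bigr _ (fun j _ => E j)) exchange_big /= mulr_sumr.
apply: eq_bigr => b _; rewrite exchange_big /= (bigD1 b)//= [X in _ + X]big1 ?addr0.
  have zb : zeta ^+ b / zeta ^+ b = 1 by rewrite divff// expf_neq0.
  rewrite (eq_bigr (fun=> (normc (x b) ^+ 2)%:C)); last first.
    by move=> j _; rewrite zb expr1n mul1r sqr_normcE.
  by rewrite big_const_ord iter_addr_0 mulr_natl.
move=> b' bb'; rewrite -mulr_suml sum_root_powers ?mul0r//.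
  by rewrite exprMn exprVn !(exprAC _ _ q) zq !expr1n divr1.
apply: contra bb' => /eqP zz; apply/eqP/val_inj => /=; apply/eqP.
have /eqP : zeta ^+ b = zeta ^+ b'.
  by apply: (mulIf (invr_neq0 (expf_neq0 b' z0))); rewrite zz divff// expf_neq0.
by rewrite (eq_prim_root_expr pz) !modn_small// eq_sym.
Qed.

(** Only the divisor a = 1 contributes to T_q, since chi vanishes at the others. *)
Lemma hecke_level (N q : nat) (chi : int -> C) (F : C -> C) (z : C) : (0 < q)%N ->
  (q %| N)%N -> dirichlet_character N chi ->
  q%:R * hecke2 chi q F z = \sum_(b < q) F ((z + b%:R) / q%:R).
Proof.
move=> q0 qN cchi; have [_ _ c0] := cchi.
have qC : q%:R != 0 :> C by rewrite pnatr_eq0 -lt0n.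
have q1 : 1%N \in divisors q by rewrite -dvdn_divisors.
rewrite /hecke2 (perm_big _ (perm_to_rem q1)) big_cons /= [X in _ + X]big1_seq ?addr0; last first.
  move=> a /andP[_]; rewrite (mem_rem_uniq _ (divisors_uniq q)) inE /=.
  rewrite -dvdn_divisors// => /andP[a1 aq].
  have -> : chi a%:Z = 0.
    apply/eqP; rewrite -[_ == _]negbK c0 /coprimez /gcdz /=.
    by rewrite (gcdn_idPl (dvdn_trans aq qN)).
  by rewrite !mul0r.
rewrite divn1 (dirichlet1 cchi) mul1r mulrA mulrA -expr2 divff ?expf_neq0// mul1r.
by apply: eq_bigr => b _; rewrite mul1r.
Qed.

(** The point (k z + b)/q, for k = (1 0; jM 1), is the image of (z + b)/q under the
    conjugate of (1 0; jN 1) by the translation by b/q.  This conjugate lies in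
    Gamma_0(N) because q divides M, and its lower right entry is 1 - bjM. *)
Lemma eigen_lower (N M q j : nat) (chi : int -> C) (F : C -> C) (lam z : C) :
  (0 < q)%N -> N = (q * M)%N -> (q %| M)%N -> dirichlet_character N chi ->
  (forall g z, Gamma0 N g -> upper_half z ->
     F (moebius g z) = chi (g 1 1) * automorphy g z ^+ 2 * F z) ->
  (forall z, upper_half z -> hecke2 chi q F z = lam * F z) ->
  upper_half z ->
  q%:R * lam * F (moebius (lower_mx (j%:Z * M%:Z)) z) =
  automorphy (lower_mx (j%:Z * M%:Z)) z ^+ 2 *
  \sum_(b < q) chi (1 - M%:Z) ^+ (b * j) * F ((z + b%:R) / q%:R).
Proof.
move=> q0 NE qM cchi FG Fh Hz.
have qC : q%:R != 0 :> C by rewrite pnatr_eq0 -lt0n.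
set k := lower_mx _.
have Sk : SL2Z k by rewrite /SL2Z /= det_mx22 !mx2E; ring.
have Hk : upper_half (moebius k z) by exact: upper_half_moebius.
have A0 := automorphy_neq0 Sk Hz.
have qN : (q %| N)%N by rewrite NE dvdn_mulr.
rewrite -mulrA -Fh// (hecke_level _ _ q0 qN cchi) mulr_sumr; apply: eq_bigr => b _.
have [m mM] := dvdnP qM.
(* The conjugate of (1 0; jN 1) by the translation by b/q; its upper right entry
   - b^2 j N / q^2 is - b^2 j m. *)
pose g := mx2 (1 + (b * j)%N%:Z * M%:Z) (- (b * b * j * m)%N%:Z) (j%:Z * N%:Z)
              (1 - (b * j)%N%:Z * M%:Z).
have Gg : Gamma0 N g.
  split; last by rewrite /g !mx2E dvdz_mull.
  by rewrite /= det_mx22 !mx2E NE !PoszM mM PoszM; ring.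
have kA : automorphy k z = j%:R * M%:R * z + 1.
  by rewrite /automorphy /k !mx2E intrM -!pmulrn.
have MC : M%:R = m%:R * q%:R :> C by rewrite mM natrM.
have Hb := upper_half_affine b q0 Hz.
have gA : automorphy g ((z + b%:R) / q%:R) = automorphy k z.
  rewrite kA /automorphy /g !mx2E NE intrB !intrM -!pmulrn ?mulr1n !natrM MC.
  by field.
have -> : (moebius k z + b%:R) / q%:R = moebius g ((z + b%:R) / q%:R).
  rewrite /moebius gA /k !mx2E /g ?mx2E !intrD mulrNz !intrM -!pmulrn ?mulr1n !natrM.
  rewrite kA in A0 *; rewrite MC in A0 *; field.
  by rewrite qC A0.
rewrite FG// gA /g !mx2E (character_progression _ NE qM cchi) -mulrA mulrCA.
by [].
Qed.

End Identities.

(** * Fourier expansions *)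

Section Fourier.
Context {R : realType}.
Local Notation C := R[i].
Local Notation normc := (@Normc.normc R).

Lemma normc_real (r : R) : normc r%:C = `|r|.
Proof. by rewrite /Normc.normc /= expr0n /= addr0 sqrtr_sqr. Qed.

Lemma normc_lt (x : C) (e : R) : (`|x| < e%:C) = (normc x < e).
Proof. by rewrite -ltcR. Qed.

Lemma cvg_normc (u : nat -> C) (l : C) :
  (u : nat -> R[i]^o) @ \oo --> (l : R[i]^o) ->
  forall e : R, 0 < e -> exists n0, forall n, (n0 <= n)%N -> normc (l - u n) < e.
Proof.
move=> /cvgrPdist_lt cu e e0.
have ec : 0 < e%:C by rewrite ltcR.
have [n0 _ h] := cu _ ec.
by exists n0 => n n0n; rewrite -normc_lt; exact: h.
Qed.

Lemma expi2piD (z w : C) : expi2pi (z + w) = expi2pi z * expi2pi w.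
Proof.
case: z w => [x y] [x' y']; rewrite /expi2pi /= !mulrDr opprD expRD cosD sinD.
by apply/eqP; rewrite eq_complex /=; apply/andP; split; apply/eqP; ring.
Qed.

Lemma expi2pi0 : expi2pi (0 : C) = 1.
Proof.
rewrite /expi2pi /= !mulr0 oppr0 expR0 cos0 sin0.
by apply/eqP; rewrite eq_complex /= !mulr0 !mul0r ?mulr1 ?subr0 ?addr0 !eqxx.
Qed.

Lemma expi2piX (n : nat) (z : C) : expi2pi (n%:R * z) = expi2pi z ^+ n.
Proof.
elim: n => [|n IH]; first by rewrite mul0r expr0 expi2pi0.
by rewrite exprS -IH -expi2piD -natr1 mulrDl mul1r addrC.
Qed.

Lemma normc_expi2pi (z : C) : normc (expi2pi z) = expR (- (2 * pi * complex.Im z)).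
Proof.
rewrite /expi2pi Normc.normcM normc_real gtr0_norm ?expR_gt0//.
by rewrite /Normc.normc cos2Dsin2 sqrtr1 mulr1.
Qed.

Lemma expi2pi1 : expi2pi (1 : C) = 1.
Proof.
rewrite /expi2pi /= mulr0 oppr0 expR0 mulr1 mulr_natl cos2pi sin2pi.
by apply/eqP; rewrite eq_complex /= !mulr0 !mul0r ?mulr1 ?subr0 ?addr0 !eqxx.
Qed.

(** A n stands for the full coefficient of e(n z), the factor sqrt n included. *)
Definition fourier_sum (A : nat -> C) (m : nat) (z : C) : C :=
  \sum_(1 <= n < m) A n * expi2pi z ^+ n.

Definition fourier_cvg (A : nat -> C) (F : C -> C) :=
  forall z, upper_half z -> forall e : R, 0 < e ->
    exists n0, forall n, (n0 <= n)%N -> normc (F z - fourier_sum A n z) < e.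

Definition fourier_tail_bound (A : nat -> C) (B : R) (F : C -> C) :=
  forall z m, 1 <= complex.Im z -> (0 < m)%N ->
    normc (F z - fourier_sum A m z) <=
      2 * B * expR (- (pi * (2 * complex.Im z - 1))) ^+ m.

Lemma fourier_expansion_cvg (a : nat -> C) (F : C -> C) :
  fourier_expansion2 a F -> fourier_cvg (fun n => a n * (Num.sqrt n%:R)%:C) F.
Proof.
move=> aF z Hz; apply: cvg_normc; have := aF z Hz.
rewrite (_ : (fun m => _) = (fourier_sum (fun n => a n * (Num.sqrt n%:R)%:C))^~ z)//.
by apply/funext => m; apply: eq_bigr => n _; rewrite expi2piX.
Qed.

Lemma geometric_tail (s : R) (m k : nat) : 0 <= s -> s <= 2^-1 -> (m <= k)%N ->
  \sum_(m <= n < k) s ^+ n <= 2 * s ^+ m.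
Proof.
move=> s0 s1 /subnKC <-; move: (k - m)%N => d; elim: d m => [|j IH] n.
  by rewrite addn0 big_geq// mulr_ge0// exprn_ge0.
rewrite addnS -addSn big_ltn ?leq_addr//.
apply: (le_trans (lerD (lexx _) (IH n.+1))).
have h := exprn_ge0 n s0.
by rewrite exprS; move: (s ^+ n) h => w w0; nra.
Qed.

(** Convergence at i/2 bounds |A n| e^(- pi n) by a constant B; at height y >= 1 the
    n-th term is then at most B s^n with s = e^(- pi (2 y - 1)) <= 1/2, and the tails
    are geometric. *)
Lemma fourier_tail (A : nat -> C) (F : C -> C) :
  fourier_cvg A F ->
  exists2 B : R, 0 < B & fourier_tail_bound A B F.
Proof.
move=> AF.
pose z0 : C := 0 +i* 2^-1.
pose u n := normc (A n * expi2pi z0 ^+ n).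
have u0 n : 0 <= u n by exact: Normc_ge0.
have [B B0 uB] : exists2 B : R, 0 < B & forall n, (0 < n)%N -> u n <= B.
  have Hz0 : upper_half z0 by rewrite /upper_half /= invr_gt0.
  have [n0 h] := AF z0 Hz0 1 ltr01.
  (* Beyond n0 a term is the difference of two partial sums within 1 of the limit. *)
  exists (2 + \sum_(n < n0) u n); first by rewrite ltr_pwDl// sumr_ge0.
  move=> n n1; have [nn0|nn0] := ltnP n n0.
    by rewrite (bigD1 (Ordinal nn0))//= addrCA lerDl addr_ge0 ?sumr_ge0.
  apply: (@le_trans _ _ 2); last by rewrite lerDl sumr_ge0.
  have -> : u n = normc ((F z0 - fourier_sum A n z0) - (F z0 - fourier_sum A n.+1 z0)).
    by rewrite /u /fourier_sum big_nat_recr//=; congr normc; ring.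
  apply: (le_trans (le_normcD _ _)); rewrite normcN -[2]/(1 + 1).
  by rewrite lerD// ltW// h// leqW.
exists B => // z m z1 m0; set s := expR _.
have s0 : 0 <= s by exact: expR_ge0.
have s1 : s <= 2^-1.
  rewrite /s expRN lef_pV2 ?posrE ?expR_gt0//.
  apply: (le_trans _ (expR_ge1Dx _)).
  have : 2 <= pi :> R by exact: pi_ge2.
  by move: (complex.Im z) z1 pi => y y1 p p2; nra.
have Hz : upper_half z by rewrite /upper_half /=; lra.
have term n : (0 < n)%N -> normc (A n * expi2pi z ^+ n) <= B * s ^+ n.
  move=> n1; have -> : normc (A n * expi2pi z ^+ n) = u n * s ^+ n.
    rewrite /u !Normc.normcM -mulrA; congr (_ * _).
    rewrite !normcX -exprMn !normc_expi2pi /s -expRD /=; congr (expR _ ^+ _).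
    by rewrite /= -mulrA mulrCA; lra.
  by rewrite ler_wpM2r ?exprn_ge0// uB.
apply/ler_addgt0Pr => e e0.
have [n0 h] := AF z Hz e e0.
pose k := maxn n0 m.
have -> : F z - fourier_sum A m z =
   (F z - fourier_sum A k z) + \sum_(m <= n < k) A n * expi2pi z ^+ n.
  rewrite {2}/fourier_sum (big_cat_nat (n := m))//=; last by rewrite leq_maxr.
  by rewrite -/(fourier_sum A m z); ring.
apply: (le_trans (le_normcD _ _)); rewrite addrC lerD//; last by rewrite ltW// h// leq_maxl.
apply: (@le_trans _ _ (\sum_(m <= n < k) B * s ^+ n)).
  rewrite [X in normc X]big_nat_cond [leRHS]big_nat_cond.
  elim/big_ind2 : _ => [|x1 x2 y1 y2 h1 h2|n /andP[/andP[mn _] _]].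
  - by rewrite Normc.normc0.
  - by apply: (le_trans (le_normcD _ _)); exact: lerD.
  - by apply: term; exact: leq_trans mn.
rewrite -mulr_sumr -mulrA mulrCA ler_wpM2l ?(ltW B0)//.
by apply: geometric_tail => //; rewrite leq_maxr.
Qed.

End Fourier.

Section CoefficientBound.
Context {R : realType}.
Local Notation C := R[i].
Local Notation mR := (measurableTypeR R).
Local Notation leb := (@lebesgue_measure R).
Local Notation normc := (@Normc.normc R).

Lemma natr_div_complex (k n : nat) : k%:R / n%:R = (k%:R / n%:R : R)%:C :> C.
Proof. by rewrite rmorphM fmorphV !rmorph_nat. Qed.

Definition unit_root (n : nat) : C := expi2pi n%:R^-1.

Lemma expi2pi_real (r : R) : expi2pi r%:C = cos (2 * pi * r) +i* sin (2 * pi * r).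
Proof.
rewrite /expi2pi /= mulr0 oppr0 expR0; apply/eqP.
by rewrite eq_complex /= !mul1r !mul0r subr0 addr0 !eqxx.
Qed.

Lemma cos_neq1 (x : R) : 0 < x -> x < 2 * pi -> cos x != 1.
Proof.
move=> x0 x2; have s0 : 0 < sin (x / 2) by rewrite sin_gt0_pi//; apply/andP; split; lra.
have -> : x = x / 2 + x / 2 by lra.
rewrite cosD; have := cos2Dsin2 (x / 2).
have : 0 < sin (x / 2) ^+ 2 by rewrite exprn_gt0.
rewrite -!expr2; move: (sin _ ^+ 2) (cos _ ^+ 2) => s c h1 h2.
by apply/negP => /eqP h3; lra.
Qed.

Lemma unit_rootX (n k : nat) : unit_root n ^+ k = expi2pi (k%:R / n%:R).
Proof. by rewrite /unit_root -expi2piX. Qed.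

Lemma unit_root_primitive (n : nat) : (0 < n)%N -> n.-primitive_root (unit_root n).
Proof.
move=> n0; have nC : n%:R != 0 :> C by rewrite pnatr_eq0 -lt0n.
have zn : unit_root n ^+ n = 1 by rewrite unit_rootX divff// expi2pi1.
have [m mz mn] := prim_order_exists n0 zn.
have [e|mn'] := eqVneq m n; first by rewrite -{1}e.
have m0 : (0 < m)%N by rewrite (prim_order_gt0 mz).
have mlt : (m < n)%N by rewrite ltn_neqAle mn' dvdn_leq.
have := prim_expr_order mz; rewrite unit_rootX natr_div_complex.
have p2 : 0 < 2 * pi :> R by rewrite mulr_gt0 ?pi_gt0.
have mn1 : 0 < m%:R / n%:R :> R by rewrite divr_gt0 ?ltr0n.
have mn2 : m%:R / n%:R < 1 :> R by rewrite ltr_pdivrMr ?ltr0n// mul1r ltr_nat.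
rewrite expi2pi_real => -[/eqP]; rewrite (negbTE (cos_neq1 _ _))//.
  exact: mulr_gt0.
by rewrite -[X in _ < X]mulr1 ltr_pM2l.
Qed.

Lemma normc_unit_root (n : nat) : (0 < n)%N -> normc (unit_root n) = 1.
Proof. by move=> n0; exact: normc_root (prim_expr_order (unit_root_primitive n0)). Qed.

Lemma normc_sum (n : nat) (x : 'I_n -> C) (r : R) : (forall i, normc (x i) <= r) ->
  normc (\sum_(i < n) x i) <= n%:R * r.
Proof.
move=> h; rewrite mulr_natl -[X in _ *+ X]card_ord -sumr_const.
elim/big_ind2 : _ => [|x1 x2 y1 y2 h1 h2|i _]; first by rewrite Normc.normc0.
- by apply: (le_trans (le_normcD _ _)); exact: lerD.
- exact: h.
Qed.

(** The finite average of e(- x) F(x + i) over the points x of (1/qm) Z / Z keeps the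
    coefficients of index 1 modulo qm only.  Grouping these points by their classes
    modulo 1/q presents q times the average as a mean of sums bounded by K.  The Fourier
    sum of length m contributes its first term exactly; the tail is O(2^-m), and m
    tends to infinity. *)
Lemma coefficient_bound (q : nat) (F : C -> C) (A : nat -> C) (B K : R) :
  (0 < q)%N -> A 1%N = 1 -> 0 < B ->
  fourier_tail_bound A B F ->
  (forall u, complex.Im u = 1 ->
     normc (\sum_(b < q) unit_root q ^- b * F (u + b%:R / q%:R)) <= K) ->
  q%:R * expR (- (2 * pi)) <= K.
Proof.
move=> q0 A1 B0 tail XK.
suff H m : (1 < m)%N -> q%:R * expR (- (2 * pi)) <= K + q%:R * (2 * B * 2^-1 ^+ m).
  apply/ler_addgt0Pr => e e0.
  pose r := q%:R * 2 * B / e.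
  (* 2^m exceeds r, so the error term is at most e. *)
  pose m := (Num.bound r).+2.
  apply: (le_trans (H m _)) => //; rewrite lerD2l.
  have qR : 0 < q%:R :> R by rewrite ltr0n.
  have r0 : 0 <= r by rewrite /r divr_ge0 ?(ltW e0)// !mulr_ge0 ?(ltW B0).
  have rm : r < 2 ^+ m.
    apply: (lt_le_trans (archi_boundP r0)); rewrite -natrX ler_nat /m.
    have h k : (k < 2 ^ k)%N by exact: ltn_expl.
    apply: (leq_trans _ (ltnW (h _))); lia.
  rewrite exprVn !mulrA ler_pdivrMr ?exprn_gt0//.
  by move: rm; rewrite /r ltr_pdivrMr// => /ltW; rewrite [e * _]mulrC.
move=> m1; have m0 : (0 < m)%N by exact: ltnW.
pose n := (q * m)%N; have n0 : (0 < n)%N by rewrite muln_gt0 q0.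
pose w := unit_root n.
have pw : n.-primitive_root w by exact: unit_root_primitive.
have w0 : w != 0.
  apply/eqP => w0; have := normc_unit_root n0; rewrite -/w w0 Normc.normc0 => /eqP.
  by rewrite eq_sym oner_eq0.
have nC : n%:R != 0 :> C by rewrite pnatr_eq0 -lt0n.
have qC : q%:R != 0 :> C by rewrite pnatr_eq0 -lt0n.
have mC : m%:R != 0 :> C by rewrite pnatr_eq0 -lt0n.
have wq : unit_root q = w ^+ m.
  rewrite /w unit_rootX /unit_root; congr expi2pi.
  by rewrite /n natrM; field; rewrite qC mC.
pose i1 : C := 0 +i* 1.
pose u (s : nat) : C := i1 + s%:R / n%:R.
have Imn (k : nat) : complex.Im (k%:R / n%:R : C) = 0.
  by rewrite natr_div_complex.
pose pt (s b : nat) : C := u s + b%:R / q%:R.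
have frac (s b : nat) : s%:R / n%:R + b%:R / q%:R = (s + b * m)%N%:R / n%:R :> C.
  have -> : n%:R = q%:R * m%:R :> C by rewrite /n natrM.
  rewrite natrD [(b * m)%:R]natrM; move: qC mC.
  by move: (q%:R : C) (m%:R : C) (s%:R : C) (b%:R : C) => Q M S B' Q0 M0; field; rewrite Q0 M0.
have ub s b : pt s b = i1 + (s + b * m)%N%:R / n%:R.
  by rewrite -frac addrA.
have Imu s : complex.Im (u s) = 1.
  by rewrite raddfD /= Imn addr0.
have eu s b : expi2pi (pt s b) = expi2pi i1 * w ^+ (s + b * m).
  by rewrite ub expi2piD /w unit_rootX.
(* Up to the factor qm, the average of e(- x) f(x + i) over the points x = (s + bm)/(qm). *)
pose T (f : C -> C) : C :=
  \sum_(s < m) w ^- s * \sum_(b < q) unit_root q ^- b * f (pt s b).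
have TF : normc (T F) <= m%:R * K.
  apply: normc_sum => s; rewrite Normc.normcM Normc.normcV normcX normc_unit_root//.
  by rewrite expr1n invr1 mul1r XK.
have TP : T (fourier_sum A m) = (m * q)%N%:R * expi2pi i1.
  have E s b : fourier_sum A m (pt s b) =
      expi2pi i1 * w ^+ (s + b * m) + \sum_(2 <= k < m)
        A k * expi2pi i1 ^+ k * (w ^+ (s + b * m)) ^+ k.
    rewrite /fourier_sum big_ltn// A1 mul1r expr1. rewrite eu; congr (_ + _).
    by apply: eq_bigr => k _; rewrite exprMn mulrA.
  have wsb s b x : w ^- s * (w ^- b * x) = (w ^+ (s + b))^-1 * x.
    by rewrite exprD invfM mulrA.
  pose c k := A k * expi2pi i1 ^+ k.
  have E2 (s : nat) : w ^- s * \sum_(b < q) unit_root q ^- b * fourier_sum A m (pt s b) =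
      q%:R * expi2pi i1 + \sum_(2 <= k < m) \sum_(b < q) c k * (w ^+ k.-1) ^+ (s + b * m).
    rewrite mulr_sumr (eq_bigr (fun b : 'I_q => expi2pi i1 + \sum_(2 <= k < m) c k * (w ^+ k.-1) ^+ (s + b * m))).
      by rewrite big_split /= big_const_ord iter_addr_0 mulr_natl exchange_big.
    move=> b _; rewrite wq -exprM E mulnC wsb mulrDr mulrCA mulVf ?expf_neq0// mulr1.
    congr (_ + _); rewrite mulr_sumr; apply: eq_big_nat => k /andP[k2 _].
    rewrite mulrCA; congr (_ * _).
    have -> : (w ^+ (s + b * m)) ^+ k = w ^+ (s + b * m) * (w ^+ k.-1) ^+ (s + b * m).
      by rewrite [in RHS]exprAC -exprS prednK// (ltn_trans _ k2).
    by rewrite mulKf// expf_neq0.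
  rewrite /T (eq_bigr (fun s : 'I_m => q%:R * expi2pi i1 +
      \sum_(2 <= k < m) \sum_(b < q) c k * (w ^+ k.-1) ^+ (s + b * m))); last by [].
  rewrite big_split /= big_const_ord iter_addr_0.
  set X := (X in _ + X); suff -> : X = 0 by rewrite addr0 [in RHS]natrM -mulrA !mulr_natl.
  rewrite /X exchange_big /= big_nat big1// => k /andP[k2 km].
  have eta1 : w ^+ k.-1 != 1.
    rewrite -(expr0 w) (eq_prim_root_expr pw) mod0n modn_small.
      by rewrite -lt0n; case: (k) k2 => [|[]].
    by apply: (leq_trans _ (leq_pmull m q0)); rewrite prednK ?(ltnW km)// (ltn_trans _ k2).
  have etan : (w ^+ k.-1) ^+ n = 1 by rewrite exprAC (prim_expr_order pw) expr1n.
  rewrite (eq_bigr (fun s : 'I_m => (w ^+ k.-1) ^+ s * \sum_(b < q) c k * ((w ^+ k.-1) ^+ m) ^+ b)); last first.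
    move=> s _; rewrite mulr_sumr; apply: eq_bigr => b _.
    by rewrite exprD mulnC exprM mulrCA.
  rewrite -mulr_suml -mulr_sumr mulrCA.
  have -> : (\sum_(s < m) (w ^+ k.-1) ^+ s) * (\sum_(b < q) ((w ^+ k.-1) ^+ m) ^+ b) = 0; last by rewrite mulr0.
  (* With eta = w^(k-1), both factors are geometric sums, and (eta - 1) times their
     product is eta^(qm) - 1 = 0. *)
  have e1 : w ^+ k.-1 - 1 != 0 by rewrite subr_eq0.
  by apply: (mulfI e1); rewrite mulr0 mulrA -subrX1 -subrX1 -exprM mulnC -/n etan subrr.
have TD : normc (T F - T (fourier_sum A m)) <= m%:R * (q%:R * (2 * B * 2^-1 ^+ m)).
  rewrite /T -sumrB; apply: normc_sum => s.
  rewrite -mulrBr Normc.normcM Normc.normcV normcX normc_unit_root// expr1n invr1 mul1r.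
  rewrite -sumrB; apply: normc_sum => b.
  rewrite -mulrBr Normc.normcM Normc.normcV normcX normc_unit_root// expr1n invr1 mul1r.
  have Imb : complex.Im (pt s b) = 1 by rewrite ub raddfD /= Imn addr0.
  apply: (le_trans (tail _ _ _ m0)); first by rewrite Imb.
  rewrite Imb ler_pM2l ?mulr_gt0// lerXn2r ?nnegrE ?expR_ge0//.
  rewrite expRN lef_pV2 ?posrE ?expR_gt0//.
  apply: (le_trans _ (expR_ge1Dx _)); have : 2 <= pi :> R by exact: pi_ge2.
  by move: pi => p p2; lra.
have mR0 : 0 < m%:R :> R by rewrite ltr0n.
have E1 : normc (T (fourier_sum A m)) = m%:R * (q%:R * expR (- (2 * pi))).
  rewrite TP Normc.normcM normc_expi2pi /= mulr1 natrM Normc.normcM mulrA.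
  by rewrite -!(rmorph_nat (real_complex R)) !normc_real !normr_nat.
have main : normc (T (fourier_sum A m)) <= m%:R * K + m%:R * (q%:R * (2 * B * 2^-1 ^+ m)).
  have -> : T (fourier_sum A m) = T F - (T F - T (fourier_sum A m)) by ring.
  by apply: (le_trans (le_normcD _ _)); rewrite normcN; exact: lerD.
rewrite E1 -mulrDr in main.
by rewrite -(ler_pM2l mR0).
Qed.

End CoefficientBound.

(** * The squared mass of a form *)

Section SquareNorm.
Context {R : realType}.
Local Notation C := R[i].
Local Notation mR := (measurableTypeR R).
Local Notation leb := (@lebesgue_measure R).
Local Notation normc := (@Normc.normc R).

Definition cmeasurable (h : mR * mR -> C) :=
  measurable_fun [set: mR * mR] (fun p => complex.Re (h p)) /\
  measurable_fun [set: mR * mR] (fun p => complex.Im (h p)).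

Lemma cmeasurable_cst (c : C) : cmeasurable (fun=> c).
Proof. by split; exact: measurable_cst. Qed.

Lemma cmeasurableD h k : cmeasurable h -> cmeasurable k -> cmeasurable (fun p => h p + k p).
Proof.
move=> [h1 h2] [k1 k2]; split.
  rewrite (_ : (fun p => _) = fun p => complex.Re (h p) + complex.Re (k p)); last first.
    by apply/funext => p; rewrite raddfD.
  exact: measurable_funD.
rewrite (_ : (fun p => _) = fun p => complex.Im (h p) + complex.Im (k p)); last first.
  by apply/funext => p; rewrite raddfD.
exact: measurable_funD.
Qed.

Lemma cmeasurableM h k : cmeasurable h -> cmeasurable k -> cmeasurable (fun p => h p * k p).
Proof.
move=> [h1 h2] [k1 k2]; split.
  rewrite (_ : (fun p => _) = fun p =>
    complex.Re (h p) * complex.Re (k p) - complex.Im (h p) * complex.Im (k p)); last first.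
    by apply/funext => p; case: (h p) (k p) => [? ?] [? ?].
  by apply: measurable_funB; exact: measurable_funM.
rewrite (_ : (fun p => _) = fun p =>
  complex.Re (h p) * complex.Im (k p) + complex.Im (h p) * complex.Re (k p)); last first.
  by apply/funext => p; case: (h p) (k p) => [? ?] [? ?].
by apply: measurable_funD; exact: measurable_funM.
Qed.

Lemma cmeasurableX h n : cmeasurable h -> cmeasurable (fun p => h p ^+ n).
Proof.
move=> mh; elim: n => [|n IH]; first exact: cmeasurable_cst.
rewrite (_ : (fun p => _) = fun p => h p * h p ^+ n); last by apply/funext => p; rewrite exprS.
exact: cmeasurableM.
Qed.

Lemma cmeasurable_sum (r : seq nat) (h : nat -> mR * mR -> C) : (forall n, cmeasurable (h n)) ->
  cmeasurable (fun p => \sum_(n <- r) h n p).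
Proof.
move=> mh; elim: r => [|n r IH].
  rewrite (_ : (fun p => _) = fun=> 0); first exact: cmeasurable_cst.
  by apply/funext => p; rewrite big_nil.
rewrite (_ : (fun p => _) = fun p => h n p + \sum_(n <- r) h n p); first exact: cmeasurableD.
by apply/funext => p; rewrite big_cons.
Qed.

Lemma cmeasurable_expi2pi : cmeasurable (fun p => expi2pi (hpoint p)).
Proof.
have m1 : measurable_fun [set: mR * mR] (fun p : mR * mR => expR p.2).
  by apply: measurableT_comp; [exact: measurable_expR | exact: measurable_snd].
have m0 : measurable_fun [set: mR * mR] (fun p : mR * mR => p.1) by exact: measurable_fst.
have mt : measurable_fun [set: mR * mR] (fun p : mR * mR => 2 * pi * (expR p.2 * p.1)).
  by apply: measurable_funM => //; exact: measurable_funM.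
have me : measurable_fun [set: mR * mR] (fun p : mR * mR => expR (- (2 * pi * expR p.2))).
  apply: measurableT_comp; first exact: measurable_expR.
  by apply: measurableT_comp => //; exact: measurable_funM.
rewrite (_ : (fun p => _) = fun p : mR * mR => (expR (- (2 * pi * expR p.2)))%:C *
  (cos (2 * pi * (expR p.2 * p.1)) +i* sin (2 * pi * (expR p.2 * p.1))))//.
apply: cmeasurableM; first by split => //=; exact: measurable_cst.
split => /=; apply: measurableT_comp => //.
  exact: continuous_measurable_fun (@continuous_cos R).
exact: continuous_measurable_fun (@continuous_sin R).
Qed.

(** |f|^2 for f(z) = Im(z) F(z). *)
Definition sqr_mass (F : C -> C) (z : C) : R := (complex.Im z * normc (F z)) ^+ 2.

Lemma sqr_mass_ge0 F z : 0 <= sqr_mass F z. Proof. exact: sqr_ge0. Qed.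

Lemma normc_Re_Im (z : C) : `|complex.Re z| <= normc z /\ `|complex.Im z| <= normc z.
Proof.
case: z => x y /=; split; rewrite -sqrtr_sqr ler_wsqrtr//.
  by rewrite lerDl sqr_ge0.
by rewrite lerDr sqr_ge0.
Qed.

(** F is the pointwise limit of its Fourier sums, which are polynomials in e(z). *)
Lemma hmeasurable_sqr_mass (A : nat -> C) (F : C -> C) :
  fourier_cvg A F ->
  hmeasurable (EFin \o sqr_mass F).
Proof.
move=> AF.
have mS n : cmeasurable (fun p => fourier_sum A n (hpoint p)).
  rewrite /fourier_sum; apply: (@cmeasurable_sum _ (fun k p => A k * expi2pi (hpoint p) ^+ k)) => k.
  by apply: cmeasurableM; [exact: cmeasurable_cst | exact/cmeasurableX/cmeasurable_expi2pi].
have mRe : measurable_fun [set: mR * mR] (fun p : mR * mR => complex.Re (F (hpoint p))).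
  apply: (@measurable_fun_cvg _ _ _ _ (fun n p => complex.Re (fourier_sum A n (hpoint p)))).
    by move=> n; case: (mS n).
  move=> p _; apply/cvgrPdist_lt => e e0.
  have [n0 h] := AF (hpoint p) (upper_half_hpoint p) e e0.
  exists n0 => // n n0n; apply: le_lt_trans (h n n0n).
  by rewrite -raddfB; case: (normc_Re_Im (F (hpoint p) - fourier_sum A n (hpoint p))).
have mIm : measurable_fun [set: mR * mR] (fun p : mR * mR => complex.Im (F (hpoint p))).
  apply: (@measurable_fun_cvg _ _ _ _ (fun n p => complex.Im (fourier_sum A n (hpoint p)))).
    by move=> n; case: (mS n).
  move=> p _; apply/cvgrPdist_lt => e e0.
  have [n0 h] := AF (hpoint p) (upper_half_hpoint p) e e0.
  exists n0 => // n n0n; apply: le_lt_trans (h n n0n).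
  by rewrite -raddfB; case: (normc_Re_Im (F (hpoint p) - fourier_sum A n (hpoint p))).
rewrite /hmeasurable; apply/measurable_EFinP; rewrite /comp.
suff -> : (fun p : mR * mR => sqr_mass F (hpoint p)) = fun p : mR * mR =>
    expR p.2 ^+ 2 * (complex.Re (F (hpoint p)) ^+ 2 + complex.Im (F (hpoint p)) ^+ 2).
  have m1 : measurable_fun [set: mR * mR] (fun p : mR * mR => expR p.2).
    by apply: measurableT_comp; [exact: measurable_expR | exact: measurable_snd].
  apply: measurable_funM; first exact: measurable_funX.
  by apply: measurable_funD; exact: measurable_funX.
apply/funext => p /=; rewrite /sqr_mass exprMn; congr (_ * _).
by case: (F (hpoint p)) => x y; rewrite /Normc.normc sqr_sqrtr// addr_ge0 ?sqr_ge0.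
Qed.

(** High in the half-plane the first term of the Fourier expansion dominates, so that
    |F(z)| >= e^(- 2 pi y) / 2; hence the mass is bounded below on a square of
    coordinates (t, eta). *)
Lemma hintegral_sqr_mass_gt0 (A : nat -> C) (F : C -> C) (B : R) :
  A 1%N = 1 -> 0 < B ->
  fourier_tail_bound A B F ->
  hmeasurable (EFin \o sqr_mass F) ->
  (0 < hintegral (EFin \o sqr_mass F))%E.
Proof.
move=> A1 B0 tail mg.
(* Beyond height Y the tail bound 2 B e^(2 pi) e^(- 4 pi y) is at most e^(- 2 pi y) / 2. *)
pose Y := 1 + 4 * B * expR (2 * pi).
have Y1 : 1 <= Y by rewrite /Y lerDl !mulr_ge0 ?expR_ge0 ?(ltW B0).
have lower z : Y <= complex.Im z -> expR (- (2 * pi * complex.Im z)) / 2 <= normc (F z).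
  move=> hz; have z1 : 1 <= complex.Im z by exact: le_trans hz.
  have := tail z 2%N z1 isT; rewrite /fourier_sum big_nat1 A1 mul1r expr1 => h.
  have h2 : normc (expi2pi z) <= normc (F z) + normc (F z - expi2pi z).
    rewrite -[normc (F z - _)]normcN.
    have {1}-> : expi2pi z = F z + - (F z - expi2pi z) by ring.
    exact: le_normcD.
  rewrite normc_expi2pi in h2.
  set y := complex.Im z in hz z1 h h2 *.
  pose E := expR (- (2 * pi * y)).
  have E0 : 0 < E by exact: expR_gt0.
  have sE : expR (- (pi * (2 * y - 1))) ^+ 2 = expR (2 * pi) * E * E.
    by rewrite -expRM_natl -!expRD; congr expR; lra.
  have small : 4 * B * expR (2 * pi) * E <= 1.
    rewrite /E expRN ler_pdivrMr ?expR_gt0// mul1r.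
    apply: (le_trans _ (expR_ge1Dx _)); apply: (le_trans (_ : _ <= y)).
      by apply: le_trans hz; rewrite /Y lerDr.
    have : 2 <= pi :> R by exact: pi_ge2.
    by move: pi => p p2; nra.
  move: h h2; rewrite sE -/E; move: small; move: (expR (2 * pi)) => c small h h2.
  have : 4 * B * c * E * E <= 1 * E by rewrite ler_wpM2r// ltW.
  by lra.
pose e1 := ln Y.
have Y0 : 0 < Y by lra.
pose c := (Y * (expR (- (2 * pi * (expR 1 * Y))) / 2)) ^+ 2.
have c0 : 0 < c by rewrite exprn_gt0// mulr_gt0// divr_gt0 ?expR_gt0.
pose I1 : set mR := `[0, 1]%classic.
pose I2 : set mR := `[e1, e1 + 1]%classic.
pose D : set (mR * mR) := I1 `*` I2.
have mI1 : measurable I1 by exact: measurable_itv.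
have mI2 : measurable I2 by exact: measurable_itv.
have mD : measurable D by exact: measurableX.
apply: (@lt_le_trans _ _ (\int[leb \x leb]_p (c%:E * (\1_D p)%:E))%E).
  rewrite ge0_integralZl//; last 2 first.
  - by apply/measurable_EFinP; exact: measurable_indic.
  - by rewrite lee_fin ltW.
  have ED : ((leb \x leb)%E D = leb I1 * leb I2)%E.
    exact: product_measure1E.
  rewrite integral_indic// setIT -[X in (_ * X)%E]/((leb \x leb)%E D) ED.
  rewrite /I1 /I2 !lebesgue_measure_itv/= !lte_fin ltr01.
  by rewrite ltrDl ltr01 -!EFinB -!EFinM lte_fin subr0 mul1r addrAC subrr add0r mulr1.
apply: ge0_le_integral => //.
- by move=> p _; rewrite mule_ge0// lee_fin// ltW.
- by apply: measurable_funeM; apply/measurable_EFinP; exact: measurable_indic.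
- move=> [t e] _; rewrite /= -EFinM lee_fin indicE.
  have [/set_mem[_ he]|_] := boolP ((t, e) \in D); last by rewrite mulr0 sqr_mass_ge0.
  move: he; rewrite /I2 /= in_itv /= mulr1 => /andP[h1 h2].
  have y1 : Y <= expR e by rewrite -[Y]lnK ?posrE// ler_expR.
  have y2 : expR e <= expR 1 * Y by rewrite -[Y]lnK ?posrE// -expRD ler_expR addrC.
  have l0 : 0 <= expR (- (2 * pi * (expR 1 * Y))) / 2 by rewrite divr_ge0 ?expR_ge0.
  rewrite /c /sqr_mass; apply: lerXn2r; rewrite ?nnegrE.
  - by apply: mulr_ge0 => //; exact: ltW.
  - by apply: mulr_ge0; [exact: expR_ge0 | exact: Normc_ge0].
  apply: ler_pM => //; first exact: ltW.
  apply: le_trans (lower _ _) => //=.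
  by rewrite ler_pM2r// ler_expR lerN2 ler_pM2l// mulr_gt0 ?pi_gt0.
Qed.

(** By Euler's theorem the nonzero values are roots of unity. *)
Lemma normc_character (N : nat) (chi : int -> C) (d : int) : (0 < N)%N ->
  dirichlet_character N chi -> coprimez d N%:Z -> normc (chi d) = 1.
Proof.
move=> N0 cchi dN; have [cP cM _] := cchi.
pose a := absz (d %% N%:Z)%Z.
have N1 : N%:Z != 0 by lia.
have aE : a%:Z = (d %% N%:Z)%Z by rewrite gez0_abs// modz_ge0.
have -> : chi d = chi a%:Z by apply: cP; rewrite aE modz_mod.
have aN : coprime a N.
  by move: dN; rewrite /coprimez -gcdz_modl -aE.
have cX n : chi (a ^ n)%N%:Z = chi a%:Z ^+ n.
  elim: n => [|n IH]; first by rewrite expn0 expr0 (dirichlet1 cchi).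
  by rewrite expnS PoszM cM IH exprS.
apply: (@normc_root _ _ (totient N)); first by rewrite totient_gt0.
rewrite -cX -(dirichlet1 cchi); apply: cP.
by have := Euler_exp_totient aN; rewrite !modz_nat => ->.
Qed.

End SquareNorm.

(** * Eigenvalue and lower bound *)

Section EigenvalueNorm.
Context {R : realType}.
Local Notation C := R[i].
Local Notation normc := (@Normc.normc R).

(** Weight two in the form used for |f|: the factor |c z + d|^2 of the form cancels
    against that of the imaginary part. *)
Lemma Im_moebius_scaling (g : 'M[int]_2) (z c w v : C) : SL2Z g -> upper_half z ->
  c * w = automorphy g z ^+ 2 * v ->
  normc c * (complex.Im (moebius g z) * normc w) = complex.Im z * normc v.
Proof.
move=> Sg Hz; rewrite expr2 => /(congr1 normc); rewrite !Normc.normcM => E.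
have A0 : normc (automorphy g z) != 0.
  by apply/eqP => /Normc.eq0_normc; apply/eqP; exact: automorphy_neq0.
by rewrite mulrCA E Im_moebius//; field.
Qed.

Lemma normc_nat (n : nat) : normc n%:R = n%:R.
Proof. by rewrite -(rmorph_nat (real_complex R)) normc_real normr_nat. Qed.

Section Eigenform.
Variables (q M N : nat) (chi : int -> C) (F : C -> C) (lam : C).
Hypotheses (q0 : (0 < q)%N) (NE : N = (q * M)%N) (qM : (q %| M)%N) (M0 : (0 < M)%N).
Hypothesis cchi : dirichlet_character N chi.
Hypothesis FG : forall g z, Gamma0 N g -> upper_half z ->
  F (moebius g z) = chi (g 1 1) * automorphy g z ^+ 2 * F z.
Hypothesis Fh : forall z, upper_half z -> hecke2 chi q F z = lam * F z.

Lemma lower_mx_SL2 c : SL2Z (lower_mx c).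
Proof. by rewrite /SL2Z /= det_mx22 !mx2E; ring. Qed.

Lemma eigen_lower_norm (j : nat) (z : C) : upper_half z ->
  q%:R * normc lam * (complex.Im (moebius (lower_mx (j%:Z * M%:Z)) z) *
    normc (F (moebius (lower_mx (j%:Z * M%:Z)) z))) =
  complex.Im z * normc (\sum_(b < q) chi (1 - M%:Z) ^+ (b * j) * F ((z + b%:R) / q%:R)).
Proof.
move=> Hz; have E := eigen_lower j q0 NE qM cchi FG Fh Hz.
rewrite -(Im_moebius_scaling (lower_mx_SL2 _) Hz E).
by rewrite Normc.normcM normc_nat.
Qed.

Lemma sqr_mass_Gamma0 g z : Gamma0 N g -> upper_half z ->
  sqr_mass F (moebius g z) = sqr_mass F z.
Proof.
move=> Gg Hz; rewrite /sqr_mass; congr (_ ^+ 2).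
have [Sg gN] := Gg.
have [_ dN] := coprime_of_det (det_SL2 Sg) gN.
have N0 : (0 < N)%N by rewrite NE muln_gt0 q0.
have E : 1 * F (moebius g z) = automorphy g z ^+ 2 * (chi (g 1 1) * F z).
  by rewrite FG//; ring.
have := Im_moebius_scaling Sg Hz E.
by rewrite normc1 mul1r Normc.normcM (normc_character N0 cchi dN) mul1r.
Qed.

(** Parseval applied to [eigen_lower_norm], j running modulo q. *)
Lemma sqr_mass_means (z : C) : q.-primitive_root (chi (1 - M%:Z)) -> upper_half z ->
  \sum_(b < q) sqr_mass F ((z + b%:R) / q%:R) =
  normc lam ^+ 2 / q%:R *
    \sum_(j < q) sqr_mass F (moebius (lower_mx ((j : nat)%:Z * M%:Z)) z).
Proof.
move=> pz Hz.
have qR : q%:R != 0 :> R by rewrite pnatr_eq0 -lt0n.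
have y0 : complex.Im z != 0 by rewrite gt_eqF.
pose x (b : 'I_q) := F ((z + b%:R) / q%:R).
have E (b : 'I_q) : sqr_mass F ((z + b%:R) / q%:R) =
    (complex.Im z / q%:R) ^+ 2 * normc (x b) ^+ 2.
  rewrite /sqr_mass exprMn; congr (_ ^+ 2 * _).
  have -> : b%:R = (b%:R : R)%:C :> C by rewrite rmorph_nat.
  have -> : q%:R^-1 = (q%:R^-1 : R)%:C :> C by rewrite fmorphV rmorph_nat.
  by case: (z) => u v /=; rewrite mulr0 add0r addr0.
rewrite (eq_bigr _ (fun b _ => E b)) -mulr_sumr.
have E2 (j : 'I_q) : normc lam ^+ 2 * sqr_mass F (moebius (lower_mx ((j : nat)%:Z * M%:Z)) z) =
    (complex.Im z / q%:R) ^+ 2 *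
    normc (\sum_(b < q) chi (1 - M%:Z) ^+ (b * j) * x b) ^+ 2.
  have := eigen_lower_norm j Hz; rewrite -/(x _) => E3.
  rewrite /sqr_mass -exprMn -[RHS]exprMn; congr (_ ^+ 2).
  by apply: (mulfI qR); rewrite mulrA E3; field.
rewrite [RHS]mulrAC [X in _ = X / _]mulr_sumr (eq_bigr _ (fun j _ => E2 j)).
rewrite -[X in _ = X / _]mulr_sumr parseval_roots//.
by field.
Qed.

Lemma eigenvalue_norm (A : nat -> C) (B K : R) :
  q.-primitive_root (chi (1 - M%:Z)) -> A 1%N = 1 -> 0 < B ->
  fourier_cvg A F ->
  fourier_tail_bound A B F ->
  (forall z, upper_half z -> complex.Im z * normc (F z) <= K) ->
  normc lam ^+ 2 = q%:R.
Proof.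
move=> pz A1 B0 AF tail FK.
have mg := hmeasurable_sqr_mass AF.
have qR : q%:R != 0 :> R by rewrite pnatr_eq0 -lt0n.
have y0 (z : C) : upper_half z -> 0 <= complex.Im z by move=> Hz; exact: ltW.
have : normc lam ^+ 2 / q%:R = 1.
  apply: (@mean_identity _ q M N (sqr_mass F) _ (K ^+ 2)) => //.
  - exact: sqr_mass_ge0.
  - move=> z Hz; rewrite /sqr_mass ler_sqr ?FK// nnegrE ?mulr_ge0 ?Normc_ge0 ?y0//.
    by apply: le_trans (FK z Hz); rewrite mulr_ge0 ?Normc_ge0 ?y0.
  - exact: sqr_mass_Gamma0.
  - exact: hintegral_sqr_mass_gt0 A1 B0 tail mg.
  - by rewrite divr_ge0// sqr_ge0.
  - by move=> z; exact: sqr_mass_means.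
by move=> /(congr1 ( *%R^~ q%:R)); rewrite mul1r divfK.
Qed.

(** For the j with zeta^j = e(-1/q), [eigen_lower_norm] at z = q u turns the bound K for
    |f| into the bound |lam| K for the sum of the e(- b/q) F(u + b/q). *)
Lemma eigenform_bound (A : nat -> C) (B K : R) :
  q.-primitive_root (chi (1 - M%:Z)) -> A 1%N = 1 -> 0 < B ->
  fourier_cvg A F ->
  fourier_tail_bound A B F ->
  (forall z, upper_half z -> complex.Im z * normc (F z) <= K) ->
  expR (- (2 * pi)) * Num.sqrt q%:R <= K.
Proof.
move=> pz A1 B0 AF tail FK.
have lamq := eigenvalue_norm pz A1 B0 AF tail FK.
have lamE : normc lam = Num.sqrt q%:R by rewrite -lamq sqrtr_sqr ger0_norm ?Normc_ge0.
have qR : 0 < q%:R :> R by rewrite ltr0n.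
have qC : q%:R != 0 :> C by rewrite pnatr_eq0 -lt0n.
have uV : (unit_root q)^-1 ^+ q = 1 :> C.
  by rewrite exprVn (prim_expr_order (unit_root_primitive q0)) invr1.
(* unit_root q is e(1/q), so that zeta^j = e(-1/q). *)
have [j jE] := prim_rootP pz uV.
have XK (u : C) : complex.Im u = 1 ->
    normc (\sum_(b < q) unit_root q ^- b * F (u + b%:R / q%:R)) <= normc lam * K.
  move=> u1; pose z : C := q%:R * u.
  have Imz : complex.Im z = q%:R.
    rewrite /z -(rmorph_nat (real_complex R)); case: (u) u1 => a b /= ->.
    by rewrite mulr1 mul0r addr0.
  have Hz : upper_half z by rewrite /upper_half /= Imz.
  have := eigen_lower_norm j Hz; rewrite Imz -mulrA => /(mulfI (lt0r_neq0 qR)) E.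
  have -> : \sum_(b < q) unit_root q ^- b * F (u + b%:R / q%:R) =
      \sum_(b < q) chi (1 - M%:Z) ^+ (b * j) * F ((z + b%:R) / q%:R).
    apply: eq_bigr => b _; rewrite mulnC exprM -jE exprVn; congr (_ * F _).
    by rewrite /z mulrDl mulrAC divff// mul1r.
  by rewrite -E ler_wpM2l ?Normc_ge0// FK//; apply: upper_half_moebius => //; exact: lower_mx_SL2.
have := coefficient_bound q0 A1 B0 tail XK.
have s0 : 0 < Num.sqrt q%:R :> R by rewrite sqrtr_gt0.
rewrite lamE -{1}[q%:R]sqr_sqrtr ?ler0n// expr2 -mulrA ler_pM2l//.
by rewrite mulrC.
Qed.

End Eigenform.
End EigenvalueNorm.

(** M is the product of the p^ceil(c/2). *)
Lemma square_divisor_split (N : nat) : (0 < N)%N ->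
  let q := (\prod_(p <- primes N) p ^ (logn p N)./2)%N in
  exists M, [/\ (0 < q)%N, N = (q * M)%N, (q %| M)%N & (0 < M)%N].
Proof.
move=> N0 q; pose M := (\prod_(p <- primes N) p ^ (logn p N - (logn p N)./2))%N.
have NE : N = (q * M)%N.
  rewrite /q /M -big_split /= {1}[N]prod_prime_decomp// prime_decompE big_map /=.
  by apply: eq_bigr => p _; rewrite -expnD subnKC//; lia.
have : (0 < q * M)%N by rewrite -NE.
rewrite muln_gt0 => /andP[q0 M0]; exists M; split => //.
rewrite /q /M; elim/big_ind2 : _ => // [a b c d|p _]; first exact: dvdn_mul.
by apply: dvdn_exp2l; lia.
Qed.

Lemma prod_sqrt_powers (R : realType) (N : nat) :
  \prod_(p <- primes N) p%:R `^ (2^-1 * (logn p N)./2%:R) =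
  Num.sqrt (\prod_(p <- primes N) p ^ (logn p N)./2)%N%:R :> R.
Proof.
have P0 : 0 <= \prod_(p <- primes N) p%:R `^ (2^-1 * (logn p N)./2%:R) :> R.
  by apply: prodr_ge0 => p _; exact: powR_ge0.
rewrite -[LHS]ger0_norm// -sqrtr_sqr natr_prod -prodrXl; congr (Num.sqrt _).
apply: eq_bigr => p _; rewrite -powR_mulrn ?powR_ge0// -powRrM mulrAC mulVf// mul1r.
by rewrite powR_mulrn// natrX.
Qed.

Theorem theorem1p2 (R : realType) :
  exists c0 : R, 0 < c0 /\
  forall (N : nat) (chi : int -> R[i]) (f : R[i] -> R[i]),
    (1 <= N)%N -> primitive_character N chi -> S2star N chi f ->
    ((c0 * \prod_(p <- primes N) p%:R `^ (2^-1 * (logn p N)./2%:R))%:E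
       <= sup_norm f)%E.
Proof.
exists (expR (- (2 * pi))); split; first exact: expR_gt0.
move=> N chi f N1 pchi [F [fF [[_ FG _] _] Fh [a aF a1]]].
have [M [q0 NE qM M0]] := square_divisor_split N1.
rewrite prod_sqrt_powers; move: q0 NE qM; set q := (\prod_(p <- _) _)%N => q0 NE qM.
have [cchi _] := pchi.
have pz := primitive_progression q0 M0 NE qM pchi.
have [lam lamE] := Fh q q0.
have AF := fourier_expansion_cvg aF.
have [B B0 tail] := fourier_tail AF.
have A1 : a 1%N * (Num.sqrt 1%:R)%:C = 1 by rewrite a1 sqrtr1 mulr1.
have ub z : upper_half z -> ((complex.Im z * Normc.normc (F z))%:E <= sup_norm f)%E.
  move=> Hz; apply: ereal_sup_ubound; exists z => //.
  by rewrite fF// Normc.normcM normc_real gtr0_norm.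
have Hi : upper_half (0 +i* 1 : R[i]) by exact: ltr01.
case E : (sup_norm f) => [K| |]; last 2 first.
- exact: leey.
- by have := ub _ Hi; rewrite E.
rewrite lee_fin; apply: (eigenform_bound q0 NE qM M0 cchi FG lamE pz A1 B0 AF tail).
by move=> z Hz; rewrite -lee_fin -E; exact: ub.
Qed.
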